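(* Let $M$ be a closed Riemannian manifold and let $f\colon M\to M$ be a $C^1$-diffeomorphism. If there is an infinite hyperbolic set $C$ for $f$ such that $f|_C\colon C\to C$ is chain transitive, then $f$ is Bohr chaotic.
   Context: A closed manifold is a compact manifold without boundary; $M$ is regarded as a compact metric space with a metric $d$ inducing its topology (e.g. the Riemannian distance). Hyperbolic set has its standard meaning: a compact set $\Lambda\subset M$ with $f(\Lambda)=\Lambda$ such that there are a $Df$-invariant splitting $T_xM=E^s_x\oplus E^u_x$, $x\in\Lambda$, and constants $c>0$, $0<\lambda<1$ with $\|Df^n_x v\|\le c\lambda^n\|v\|$ for $v\in E^s_x$ and $\|Df^{-n}_x v\|\le c\lambda^n\|v\|$ for $v\in E^u_x$, for all $x\in\Lambda$ and $n\ge0$. Chain transitivity: a finite sequence $(x_i)_{i=0}^k$, $k\ge1$, is a $\delta$-chain of a homeomorphism $g\colon Z\to Z$ of a compact metric space if $d(g(x_i),x_{i+1})\le\delta$ for all $0\le i\le k-1$. $g$ is chain transitive if for any $x,y\in Z$ and $\delta>0$ there is a $\delta$-chain $(x_i)_{i=0}^k$ of $g$ with $x_0=x$ and $x_k=y$. Bohr chaos: for a compact metric space $X$ let $C(X)$ be the set of continuous real-valued functions on $X$. A continuous map $f\colon X\to X$ is Bohr chaotic if for every bounded sequence $(a_i)_{i\ge0}$ of real numbers with $\limsup_{n\to\infty}\frac1n\sum_{i=0}^{n-1}|a_i|>0$ there are $x\in X$ and $\phi\in C(X)$ with $\limsup_{n\to\infty}\frac1n\left|\sum_{i=0}^{n-1}a_i\phi(f^i(x))\right|>0$.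 *)

(* Defs.v *)
From HB Require Import structures.
From mathcomp Require Import all_boot all_order all_algebra.
From mathcomp Require Import all_classical all_reals all_analysis.

Set Implicit Arguments.
Unset Strict Implicit.
Unset Printing Implicit Defensive.

Import Order.TTheory GRing.Theory Num.Theory.
Import numFieldNormedType.Exports.

Local Open Scope classical_set_scope.
Local Open Scope ring_scope.

(* Only meaningful for U open: differentiability and continuity are taken in   *)
(* the full neighbourhood filter of each point of U. As V is finite            *)
(* dimensional in all uses, continuity of all directional derivatives is       *)
(* continuity of the differential.                                             *)
Fixpoint Ck_on (R : realType) (V W : normedModType R) (k : nat) (U : set V)
    (h : V -> W) : Prop :=
  match k with
  | 0 => forall x, U x -> {for x, continuous h}
  | k'.+1 => (forall x, U x -> differentiable h x) /\
             (forall v, Ck_on k' U (fun x => 'd h x v))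
  end.

Definition smooth_on (R : realType) (V W : normedModType R) (U : set V)
  (h : V -> W) : Prop := forall k, Ck_on k U h.

(* [chart i] and [chart_inv i] are total functions; their values outside       *)
(* [chart_dom i] and [chart i @` chart_dom i], respectively, are irrelevant.     *)
Record atlas (R : realType) (n : nat) (M : topologicalType) := Atlas {
  chart_index : Type;
  chart_dom : chart_index -> set M;
  chart : chart_index -> M -> 'rV[R]_n;
  chart_inv : chart_index -> 'rV[R]_n -> M;
  chart_at : M -> chart_index;
  dom_open : forall i, open (chart_dom i);
  codom_open : forall i, open (chart i @` chart_dom i);
  chartK : forall i x, chart_dom i x -> chart_inv i (chart i x) = x;
  chart_continuous : forall i x, chart_dom i x -> {for x, continuous (chart i)};
  chart_inv_continuous : forall i y, (chart i @` chart_dom i) y ->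
    {for y, continuous (chart_inv i)};
  mem_chart_at : forall x, chart_dom (chart_at x) x;
  transition_smooth : forall i j,
    smooth_on (chart i @` (chart_dom i `&` chart_dom j)) (chart j \o chart_inv i)
}.

Section Manifold.
Variables (R : realType) (n : nat).
Implicit Types M : metricType R.

Definition in_charts M (A : atlas R n M) (f : M -> M) (i j : chart_index A) :
  'rV[R]_n -> 'rV[R]_n := chart j \o f \o chart_inv i.

Definition C1_map M (A : atlas R n M) (f : M -> M) : Prop :=
  continuous f /\
  forall i j : chart_index A,
    Ck_on 1 (chart i @` (chart_dom i `&` f @^-1` chart_dom j)) (in_charts f i j).

Definition C1_diffeo M (A : atlas R n M) (f finv : M -> M) : Prop :=
  [/\ cancel f finv, cancel finv f, C1_map A f & C1_map A finv].

(* T_xM is identified with R^n through the coordinates of the preferred chart  *)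
(* [chart_at A x]; under this identification the next map is D_x f, from T_xM  *)
(* to T_{f x}M.                                                                *)
Definition tangent_map M (A : atlas R n M) (f : M -> M) (x : M) :
    'Hom('rV[R]_n, 'rV[R]_n) :=
  linfun ('d (in_charts f (chart_at A x) (chart_at A (f x)))
             (chart (chart_at A x) x)).

(* For x = chart_inv i y, this sends the components in chart i of a tangent    *)
(* vector at x to its components in the preferred chart at x.                  *)
Definition to_preferred M (A : atlas R n M) (i : chart_index A) (y v : 'rV[R]_n) :
    'rV[R]_n :=
  'd (chart (chart_at A (chart_inv i y)) \o chart_inv i) y v.

Definition inner_prod (G : 'M[R]_n) (u v : 'rV[R]_n) : R := (u *m G *m v^T) 0 0.

(* [gram x] is the matrix of the inner product on T_xM in the preferred chart  *)
(* at x, which need not vary continuously with x; smoothness is therefore      *)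
(* required of the components of the metric in every fixed chart.              *)
Record riemannian_metric M (A : atlas R n M) := RiemannianMetric {
  gram : M -> 'M[R]_n;
  gram_sym : forall x, (gram x)^T = gram x;
  gram_posdef : forall x v, v != 0 -> 0 < inner_prod (gram x) v v;
  gram_smooth : forall (i : chart_index A) (u v : 'rV[R]_n),
    smooth_on (W := R^o) (chart i @` chart_dom i)
      (fun y => inner_prod (gram (chart_inv i y))
                      (to_preferred i y u) (to_preferred i y v))
}.

Definition tangent_norm M (A : atlas R n M) (g : riemannian_metric A) (x : M)
  (v : 'rV[R]_n) : R := Num.sqrt (inner_prod (gram g x) v v).

Definition hyperbolic_set M (A : atlas R n M) (g : riemannian_metric A)
    (f finv : M -> M) (L : set M) : Prop :=
  [/\ compact L, f @` L = L &
    exists (Es Eu : M -> {vspace 'rV[R]_n}) (c lambda : R),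
      [/\ 0 < c, 0 < lambda < 1 &
        forall x, L x ->
        [/\ (Es x + Eu x)%VS = fullv /\ (Es x :&: Eu x)%VS = 0%VS,
            (tangent_map A f x @: Es x)%VS = Es (f x),
            (tangent_map A f x @: Eu x)%VS = Eu (f x),
            forall (k : nat) v, v \in Es x ->
              tangent_norm g (iter k f x) (tangent_map A (iter k f) x v)
                <= c * lambda ^+ k * tangent_norm g x v &
            forall (k : nat) v, v \in Eu x ->
              tangent_norm g (iter k finv x) (tangent_map A (iter k finv) x v)
                <= c * lambda ^+ k * tangent_norm g x v]]].

End Manifold.

(* Chains of the restriction of f to an f-invariant set Z, with the restricted *)
(* distance.                                                                   *)
Definition delta_chain (R : realType) (X : metricType R) (Z : set X)
    (f : X -> X) (delta : R) (k : nat) (x : nat -> X) : Prop :=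
  [/\ (1 <= k)%N, forall i, (i <= k)%N -> Z (x i) &
      forall i, (i < k)%N -> mdist (f (x i)) (x i.+1) <= delta].

Definition chain_transitive_on (R : realType) (X : metricType R) (Z : set X)
    (f : X -> X) : Prop :=
  forall x y, Z x -> Z y -> forall delta : R, 0 < delta ->
    exists (k : nat) (s : nat -> X),
      [/\ delta_chain Z f delta k s, s 0%N = x & s k = y].

Definition bohr_chaotic (R : realType) (X : metricType R) (f : X -> X) : Prop :=
  forall a : nat -> R, bounded_fun a ->
    (0 < limn_esup (fun k => (k%:R^-1 * \sum_(0 <= i < k) `|a i|)%:E))%E ->
    exists (x : X) (phi : X -> R), continuous phi /\
      (0 < limn_esup (fun k =>
         (k%:R^-1 * `|\sum_(0 <= i < k) a i * phi (iter i f x)|)%:E))%E.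

(* Main.v *)
Require Import Defs.
From HB Require Import structures.
From mathcomp Require Import all_boot all_order all_algebra.
From mathcomp Require Import all_classical all_reals all_analysis.
From mathcomp Require Import finmap zify ring lra.

(* Hyperbolicity gives a finite time estimate which does not involve the       *)
(* continuity of the splitting: along an orbit segment q_0, ..., q_2m in C, a  *)
(* solution of v_{l+1} = Df(q_l) v_l + w_l satisfies                           *)
(* |v_m| <= max(|v_0|, |v_2m|) / 4 + K max |w_l|. Being an open condition, it  *)
(* persists along pseudo-orbits. It yields uniform expansivity directly, and   *)
(* it shows that for a closed pseudo-orbit the operator                        *)
(* v |-> (v_{i+1} - Df v_i)_i, whose source and target have the same           *)
(* dimension, is injective with inverse bounded by 2K; the contraction         *)
(* principle then shadows every closed pseudo-orbit. Chain transitivity        *)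
(* closes up all the pseudo-orbits that are needed.                            *)
(*                                                                             *)
(* Since C is infinite, two points at expansive distance are reached from a    *)
(* common point by chains of equal length, whence two loops u, v at a point    *)
(* x, of the same length N, with u_T = x and v_T = y far from x. Splicing u    *)
(* and v along the code 1 0^(K-1) 1 0^K produces a block which, by             *)
(* expansivity, can be recognized in a coarse sense only at multiples of its   *)
(* length P. A continuous function testing for this block along a shadowing    *)
(* orbit thus picks out any prescribed subset of a residue class modulo P, in  *)
(* particular the indices where a_i > 0, or where a_i < 0.                     *)

Set Implicit Arguments.
Unset Strict Implicit.
Unset Printing Implicit Defensive.

Import Order.TTheory GRing.Theory Num.Theory.
Import numFieldNormedType.Exports.

Local Open Scope classical_set_scope.
Local Open Scope ring_scope.

(** * Strict differentiability *)

(** The argument has a differentiable half and a metric half. The differentiable half yields two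
    facts: closed pseudo-orbits in [C] are shadowed by true orbits ([loop_shadowing]), and two long
    pseudo-orbits in [C] that stay [e]-close are as close as desired at their middle
    ([pseudo_orbit_expansive]). Both come from [pseudo_estimate], a perturbation of
    [orbit_estimate]: a sequence of vectors that almost follows [Df] along a window of fixed length
    is bounded at the middle by half its maximum plus a multiple of its defect. For the difference
    of two pseudo-orbits read in charts this is a contraction towards zero; around a loop it makes
    the linearized shadowing equation uniformly solvable.

    The metric half, [shadowing_expansive_bohr_chaotic], takes only these two facts from
    hyperbolicity. Chain transitivity and infinitude of [C] give two distinguishable loops at one
    point ([separated_loops]), so any 0-1 sequence can be written as a pseudo-orbit and shadowed. A
    block occurring only where it was deliberately inserted ([marker_recognition]) gives a
    continuous function which along the shadowing orbit is exactly the indicator of a prescribed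
    subset of a residue class modulo P. Choosing the indices of one residue and one sign of [a i]
    gives 2P orbit sums, and a signed combination of them is the sum of the [|a i|]; so one of them
    has a positive upper mean ([bohr_chaotic_residue]). *)

Lemma near_imp (T : topologicalType) (x : T) (P Q : T -> Prop) :
  (forall y, P y -> Q y) -> (\forall y \near x, P y) -> \forall y \near x, Q y.
Proof. by move=> PQ; apply: filterS. Qed.

Lemma near_forall (T : topologicalType) (x : T) (I : finType) (P : I -> T -> Prop) :
  (forall i, \forall y \near x, P i y) -> \forall y \near x, forall i, P i y.
Proof. exact: filter_forall. Qed.

Lemma mx_norm_entry (R : realType) m n (v : 'M[R]_(m, n)) i j : `|v i j| <= `|v|.
Proof.
rewrite [leRHS]/Num.Def.normr/= mx_normrE.
exact: (le_bigmax _ (fun ij => `|v ij.1 ij.2|) (i, j)).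
Qed.

Lemma mx_norm_le (R : realType) m n (v : 'M[R]_(m, n)) (b : R) :
  0 <= b -> (forall i j, `|v i j| <= b) -> `|v| <= b.
Proof.
move=> b0 vb; by rewrite [leLHS]/Num.Def.normr/= mx_normrE bigmax_le.
Qed.

Section Calculus.
Variables (R : realType) (m n : nat).
Local Notation V := 'rV[R]_m.
Local Notation W := 'rV[R]_n.

(** The differential depends only on the germ. Chart computations need this because a composite read
    in charts agrees with the composite of the chart expressions only near the point. *)
Lemma near_eq_diff (h h' : V -> W) x :
  (\forall y \near x, h y = h' y) -> differentiable h x ->
  differentiable h' x /\ ('d h' x = 'd h x :> (V -> W)).
Proof.
move=> hh' dh.
have cd : continuous ('d h x) by apply: diff_continuous.
have key : h' \o shift x = cst (h' x) + 'd h x +o_ 0 id.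
  apply/eqaddoP => e e0.
  have /eqaddoP/(_ e e0) H1 := diff_locally dh.
  have H2 : \forall y \near (0 : V), h (y + x) = h' (y + x).
    by move: hh'; rewrite (near_shift 0) subr0.
  have E0 : h x = h' x by exact: nbhs_singleton hh'.
  near=> y.
  have E : h (y + x) = h' (y + x) by near: y.
  have : `|(h \o shift x - (cst (h x) + 'd h x)) y| <= e * `|y| by near: y.
  by rewrite !fctE /= E E0.
have E : 'd h' x = 'd h x :> (V -> W) by exact: diff_unique.
split; last exact: E.
apply/diff_locallyP.
rewrite E.
exact: (conj cd key).
Unshelve. all: by end_near. Qed.

Lemma linear_norm_basis (L : {linear V -> W}) (e : R) w :
  (forall i, `|L (delta_mx 0 i)| <= e) -> `|L w| <= (m%:R * e) * `|w|.
Proof.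
move=> Le; rewrite {1}(row_sum_delta w) linear_sum.
apply: (le_trans (ler_norm_sum _ _ _)).
apply: (@le_trans _ _ (\sum_(i < m) e * `|w|)).
  apply: ler_sum => i _; rewrite linearZ /= normrZ mulrC.
  by apply: ler_pM => //; exact: mx_norm_entry.
by rewrite sumr_const card_ord -mulrnAl mulr_natl.
Qed.

(** [Ck_on 1] makes each directional derivative continuous; testing on basis vectors upgrades this
    to continuity in operator norm. The divisor [m.+1] absorbs the factor [m] of [linear_norm_basis]
    and is nonzero even for [m = 0]. *)
Lemma C1_diff_near (U : set V) (h : V -> W) (x : V) (e : R) :
  Ck_on 1 U h -> U x -> 0 < e ->
  \forall y \near x, forall w, `|'d h y w - 'd h x w| <= e * `|w|.
Proof.
move=> [_ /= ch] Ux e0.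
pose e' := e / m.+1%:R.
have e'0 : 0 < e' by rewrite divr_gt0.
have : \forall y \near x, forall i : 'I_m,
   `|'d h y (delta_mx 0 i) - 'd h x (delta_mx 0 i)| <= e'.
  apply: near_forall => i.
  have /cvgrPdist_le/(_ e' e'0) H := ch (delta_mx 0 i) x Ux.
  apply: near_imp H => y.
  move=> Hy.
  rewrite distrC.
  exact: Hy.
apply: near_imp => y H w.
have := @linear_norm_basis ('d h y \- 'd h x) e' w H.
move=> /= H1; apply: (le_trans H1); apply: ler_wpM2r => //.
rewrite /e' mulrCA; apply: ler_piMr; first exact: ltW.
by rewrite ler_pdivrMr// mul1r ler_nat.
Qed.

(** The norm is the maximum norm, so one entry at a time suffices, and there the scalar mean value
    theorem applies to [h - L] along the segment. *)
Lemma mean_value_bound (h : V -> W) (L : {linear V -> W}) (B : set V) (e : R)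
    (u v : V) :
  continuous L -> 0 <= e ->
  (forall t : R, 0 <= t <= 1 -> B (v + t *: (u - v))) ->
  (forall y, B y -> differentiable h y) ->
  (forall y w, B y -> `|'d h y w - L w| <= e * `|w|) ->
  `|h u - h v - L (u - v)| <= e * `|u - v|.
Proof.
move=> cL e0 Bseg dh He.
apply: mx_norm_le; first by rewrite mulr_ge0.
move=> i j.
pose p (t : R) := v + t *: (u - v).
pose f (t : R) : R := (h (p t)) i j - t * (L (u - v)) i j.
pose df (t : R) : R := ('d h (p t) (u - v)) i j - (L (u - v)) i j.
have dp t : is_diff t p ( *:%R^~ (u - v)).
  have H : is_diff t (cst v + ( *:%R^~ (u - v))) (0 + ( *:%R^~ (u - v))).
    exact: is_diffD.
  by apply: is_diff_eq H _; rewrite add0r.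
have dco (w : W) : differentiable (fun N : W => N i j : R) w.
  exact: differentiable_coord.
have dcv (w : W) : 'd (fun N : W => N i j : R) w = (fun N : W => N i j : R) :> (W -> R).
  have @c : {linear W -> R}.
    by exists (fun N : 'M[R]_(_, _) => N i j); do 2![eexists]; do ?[constructor];
       rewrite ?mxE// => ? *; rewrite ?mxE//; move=> ?; rewrite !mxE.
  have -> : (fun N : W => N i j : R) = c by [].
  rewrite diff_lin//; exact: coord_continuous.
have dhp (t : R) : 0 <= t <= 1 -> is_derive t (1:R) (fun t => h (p t) i j)
   ('d h (p t) (u - v) i j).
  move=> t01.
  have dt : differentiable (fun t => h (p t) i j : R) t.
    apply: (@differentiable_comp _ _ _ _ (h \o p) (fun N : W => N i j : R)) => //.
    by apply: differentiable_comp => //; apply: dh; exact: Bseg.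
  apply: DeriveDef; first exact: diff_derivable.
  rewrite deriveE//.
  have := @diff_comp _ _ _ _ (h \o p) (fun N : W => N i j : R) t.
  have dhp' : differentiable (h \o p) t.
    by apply: differentiable_comp => //; apply: dh; exact: Bseg.
  move=> /(_ dhp' (dco _)) ->.
  rewrite /= dcv diff_comp//=; last by apply: dh; exact: Bseg.
  by rewrite diff_val scale1r.
have fd (t : R) : 0 <= t <= 1 -> is_derive t (1:R) f (df t).
  move=> t01; have H := dhp _ t01.
  apply: is_deriveB.
  apply: DeriveDef; first by [].
  have -> : (fun t0 : R => t0 * L (u - v) i j) = (L (u - v) i j) *: (id : R -> R).
    by apply/funext => z; rewrite !fctE mulrC.
  by rewrite deriveZ// derive_id /= [LHS]mulr1.
have [c c01] : exists2 c, c \in `[0, 1]%R & f 1 - f 0 = df c * (1 - 0).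
  apply: MVT_segment => //.
    move=> t; rewrite in_itv /= => /andP[t0 t1]; apply: fd.
    by rewrite !ltW.
  apply: derivable_within_continuous => t; rewrite in_itv /= => t01.
  by have := fd t t01; case.
have p1 : p 1 = u by rewrite /p scale1r addrC subrK.
have p0 : p 0 = v by rewrite /p scale0r addr0.
rewrite subr0 mulr1 /f p1 p0 mul1r mul0r subr0.
move=> E.
have -> : (h u - h v - L (u - v)) i j = h u i j - L (u - v) i j - h v i j.
  rewrite !mxE; ring.
rewrite E /df.
have Bc : B (p c) by apply: Bseg; move: c01; rewrite in_itv.
apply: le_trans (He _ (u - v) Bc).
have := mx_norm_entry ('d h (p c) (u - v) - L (u - v)) i j.
by rewrite !mxE.
Qed.

(** Strict differentiability: with both points moving, the remainder is Lipschitz with a small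
    constant. Expansivity and the contraction used for shadowing both need this form. *)
Lemma C1_strict (U : set V) (h : V -> W) (x : V) (e : R) :
  open U -> Ck_on 1 U h -> U x -> 0 < e ->
  \forall r \near 0^'+, forall u v, `|u - x| <= r -> `|v - x| <= r ->
    `|h u - h v - 'd h x (u - v)| <= e * `|u - v|.
Proof.
move=> oU h1 Ux e0.
have A := C1_diff_near h1 Ux e0.
have B : nbhs x U by exact: open_nbhs_nbhs.
have /nbhs_ballP [d /= d0 dB] : nbhs x
    (U `&` [set y | forall w, `|'d h y w - 'd h x w| <= e * `|w|]).
  exact: filterI.
near=> r => u v ur vr.
apply: (@mean_value_bound h ('d h x) (ball x d)).
- by case: h1 => /(_ _ Ux) dx _; exact: diff_continuous.
- exact: ltW.
- move=> t /andP[t0 t1]; rewrite -ball_normE /=.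
  rewrite distrC (_ : _ - _ = t *: (u - x) + (1 - t) *: (v - x)).
    apply: (le_lt_trans (ler_normD _ _)); rewrite !normrZ.
    rewrite !ger0_norm ?subr_ge0//.
    apply: (@le_lt_trans _ _ (t * r + (1 - t) * r)).
      by apply: lerD; apply: ler_wpM2l => //; rewrite subr_ge0.
    rewrite -mulrDl addrC subrK mul1r.
    by near: r; apply: nbhs_right_lt.
  rewrite scalerBl scale1r !scalerBr.
  rewrite opprB; apply/matrixP => i j; rewrite !mxE; ring.
- by move=> y /dB [Uy _]; case: h1 => /(_ _ Uy).
- by move=> y w /dB [_ ]; apply.
Unshelve. all: by end_near. Qed.

End Calculus.

(** * Charts and the tangent map *)

Section MetricLemmas.
Variables (R : realType) (M : metricType R).
Implicit Types x y z : M.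

Lemma mdist_diff x y z : `|mdist x y - mdist x z| <= mdist y z.
Proof.
have H1 := metric_triangle x y z; have H2 := metric_triangle x z y.
have H3 := metric_sym y z; rewrite ler_norml; apply/andP; split; lra.
Qed.

Lemma near_mdist x (e : R) : 0 < e -> \forall y \near x, mdist x y <= e.
Proof.
move=> e0; have := nbhsx_ballx x _ e0; apply: filter_app.
by apply: nearW => y; rewrite ballEmdist /= => /ltW.
Qed.

Lemma mdist_continuous x : continuous (mdist x : M -> R).
Proof.
move=> y; apply/cvgrPdist_le => e e0; have := near_mdist y e0.
by apply: near_imp => z; apply: le_trans; exact: mdist_diff.
Qed.

Lemma closed_mdist_le x (e : R) : closed [set y | mdist x y <= e].
Proof.
have -> : [set y | mdist x y <= e] = (mdist x : M -> R) @^-1` [set t | t <= e] by [].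
by apply: closed_comp => [y _|]; [exact: mdist_continuous|exact: closed_le].
Qed.

Lemma open_mdist_lt x (e : R) : open [set y | mdist x y < e].
Proof.
have -> : [set y | mdist x y < e] = (mdist x : M -> R) @^-1` [set t | t < e] by [].
by apply: open_comp => [y _|]; [exact: mdist_continuous|exact: open_lt].
Qed.

Lemma near_mdist_sub x (P : set M) : (\forall y \near x, P y) ->
  \forall r \near (0:R)^'+, forall y, mdist x y <= r -> P y.
Proof.
move=> /nbhs_ballP [d /= d0 dP]; near=> r => y yr.
apply: dP; rewrite ballEmdist /=; apply: le_lt_trans yr _.
by near: r; apply: nbhs_right_lt.
Unshelve. all: by end_near. Qed.

(** Compactness makes local bounds uniform. The conclusion remains a filter statement in [r], so
    that several bounds can be combined before a radius is fixed. *)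
Lemma finite_uniform (I : choiceType) (D : {fset I}) (K : I -> set M)
    (P : R -> I -> M -> Prop) :
  (forall i, i \in D -> compact (K i)) ->
  (forall i q0, i \in D -> K i q0 ->
     \forall q \near q0 & r \near (0:R)^'+, K i q -> P r i q) ->
  \forall r \near (0:R)^'+, forall i q, i \in D -> K i q -> P r i q.
Proof.
move=> cK H.
have : \forall r \near (0:R)^'+, (\bigcap_(i in [set` D]) [set r | forall q, K i q -> P r i q]) r.
  apply: filter_bigI => i iD.
  have /compact_near_coveringP/near_covering_withinP cov := cK i iD.
  exact: (cov R (0:R)^'+ (fun r q => P r i q) _ (fun q0 Kq0 => H i q0 iD Kq0)).
by apply: filterS => r H1 i q iD; exact: (H1 i iD q).
Qed.

End MetricLemmas.

Section Charts.
Variables (R : realType) (n : nat) (M : metricType R) (A : atlas R n M).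
Local Notation V := 'rV[R]_n.
Local Notation I := (chart_index A).
Implicit Types (i j k : I) (h : M -> M) (x : M).

Lemma chart_inv_cvg i x : chart_dom i x -> chart_inv i @ chart i x --> x.
Proof.
move=> dx; have cx : (chart i @` chart_dom i) (chart i x) by exists x.
have H : chart_inv i @ chart i x --> chart_inv i (chart i x).
  exact: chart_inv_continuous.
by move: H; rewrite chartK.
Qed.

Lemma chart_image_open i (U : set M) : open U -> open (chart i @` (chart_dom i `&` U)).
Proof.
move=> oU; rewrite openE => _ [x [dx Ux] <-].
have H := chart_inv_cvg dx.
have oUd : open (chart_dom i `&` U) by apply: openI => //; exact: dom_open.
have B : nbhs (chart i x) [set y | (chart_dom i `&` U) (chart_inv i y)].
  by apply: H; apply: open_nbhs_nbhs.
have C : nbhs (chart i x) (chart i @` chart_dom i).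
  by apply: open_nbhs_nbhs; split => //; exact: codom_open.
apply: (@near_imp _ (chart i x) _ _ _ (filterI B C)).
by move=> y /= [[_ +] [z dz zy]]; rewrite -zy chartK// => Uz; exists z.
Qed.

Definition chart_diff h i j x : {linear V -> V} := 'd (in_charts h i j) (chart i x).

Definition diff_at h x := {for x, continuous h} /\
  forall i j, chart_dom i x -> chart_dom j (h x) ->
    differentiable (in_charts h i j) (chart i x).

(** The chain rule through an intermediate chart [j]. With [id] as one of the maps it gives every
    change-of-chart formula. *)
Lemma chart_diff_comp h1 h2 i j k x :
  chart_dom i x -> chart_dom j (h1 x) -> chart_dom k (h2 (h1 x)) ->
  diff_at h1 x -> diff_at h2 (h1 x) ->
  differentiable (in_charts (h2 \o h1) i k) (chart i x) /\
  forall v, chart_diff (h2 \o h1) i k x v =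
            chart_diff h2 j k (h1 x) (chart_diff h1 i j x v).
Proof.
move=> di dj dk [c1 d1] [c2 d2].
have D1 := d1 _ _ di dj; have D2 := d2 _ _ dj dk.
have E0 : in_charts h1 i j (chart i x) = chart j (h1 x).
  by rewrite /in_charts /= chartK.
have D2' : differentiable (in_charts h2 j k) (in_charts h1 i j (chart i x)).
  by rewrite E0.
have E : \forall y \near chart i x,
    (in_charts h2 j k \o in_charts h1 i j) y = in_charts (h2 \o h1) i k y.
  have : \forall y \near chart i x, chart_dom j (h1 (chart_inv i y)).
    have : h1 \o chart_inv i @ chart i x --> h1 x.
      by apply: cvg_comp (chart_inv_cvg di) c1.
    by apply; apply: open_nbhs_nbhs; split => //; exact: dom_open.
  by apply: near_imp => y dy; rewrite /in_charts /= chartK.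
have [D3 E3] := near_eq_diff E (differentiable_comp D1 D2').
split; first exact: D3.
move=> v; apply: (eq_trans (congr1 (fun F => F v) E3)).
apply: (eq_trans (congr1 (fun F => F v) (diff_comp D1 D2'))).
by rewrite /chart_diff /= E0.
Qed.

Lemma diff_at_comp h1 h2 x : diff_at h1 x -> diff_at h2 (h1 x) ->
  diff_at (h2 \o h1) x.
Proof.
move=> H1 H2; split.
  by apply: continuous_comp; [exact: (proj1 H1)|exact: (proj1 H2)].
move=> i j di dj; have dk := mem_chart_at A (h1 x).
by have [] := @chart_diff_comp h1 h2 _ _ _ _ di dk dj H1 H2.
Qed.

Lemma diff_at_id x : diff_at id x.
Proof.
split=> [//|i j di dj].
have [+ _] := @transition_smooth _ _ _ _ i j 1%N.
by apply; exists x.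
Qed.

Lemma C1_diff_at h x : C1_map A h -> diff_at h x.
Proof.
move=> [ch H]; split=> [|i j di dj]; first exact: ch.
by have [+ _] := H i j; apply; exists x.
Qed.

Lemma diff_at_iter h (k : nat) x : C1_map A h -> diff_at (iter k h) x.
Proof.
move=> Ch; elim: k => [|k IH]; first exact: diff_at_id.
exact: (@diff_at_comp (iter k h) h x IH (C1_diff_at _ Ch)).
Qed.

Lemma chart_diff_id i x v : chart_dom i x -> chart_diff id i i x v = v.
Proof.
move=> di.
have E : \forall y \near chart i x, (id : V -> V) y = in_charts id i i y.
  have : nbhs (chart i x) (chart i @` chart_dom i).
    by apply: open_nbhs_nbhs; split; [exact: codom_open|exists x].
  by apply: near_imp => y [z dz <-]; rewrite /in_charts /= chartK.
have [_ E3] := near_eq_diff E (@ex_diff _ _ _ _ _ _ _ (is_diff_id _)).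
by rewrite /chart_diff E3 diff_val.
Qed.

Lemma tangent_mapE h x v :
  tangent_map A h x v = chart_diff h (chart_at A x) (chart_at A (h x)) x v.
Proof. by rewrite /tangent_map lfunE. Qed.

Definition to_tangent i x : {linear V -> V} := chart_diff id i (chart_at A x) x.

Lemma to_preferredE i x v : chart_dom i x ->
  to_preferred i (chart i x) v = to_tangent i x v.
Proof. by move=> di; rewrite /to_preferred chartK. Qed.

Lemma to_tangentK i x v : chart_dom i x ->
  chart_diff id (chart_at A x) i x (to_tangent i x v) = v.
Proof.
move=> di; have dk := mem_chart_at A x.
have [_ /(_ v)] := @chart_diff_comp id id _ _ _ _ di dk di (diff_at_id x) (diff_at_id x).
move=> H; apply: (eq_trans (esym H)); exact: chart_diff_id.
Qed.

Lemma to_tangentVK i x v : chart_dom i x ->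
  to_tangent i x (chart_diff id (chart_at A x) i x v) = v.
Proof.
move=> di; have dk := mem_chart_at A x.
have [_ /(_ v)] := @chart_diff_comp id id _ _ _ _ dk di dk (diff_at_id x) (diff_at_id x).
move=> H; apply: (eq_trans (esym H)); exact: chart_diff_id.
Qed.

(** Both sides are the differential of [h] from chart [i] to the preferred chart at [h x], factored
    through chart [j] at the target or through the preferred chart at the source. *)
Lemma to_tangent_diff h i j x v : diff_at h x ->
  chart_dom i x -> chart_dom j (h x) ->
  to_tangent j (h x) (chart_diff h i j x v) = tangent_map A h x (to_tangent i x v).
Proof.
move=> Dh di dj; rewrite tangent_mapE.
have dx := mem_chart_at A x; have dhx := mem_chart_at A (h x).
have [_ /(_ v) E1] := @chart_diff_comp h id _ _ _ _ di dj dhx Dh (diff_at_id (h x)).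
have [_ /(_ v) E2] := @chart_diff_comp id h _ _ _ _ di dx dhx (diff_at_id x) Dh.
exact: (eq_trans (esym E1) E2).
Qed.

Lemma tangent_map_comp h1 h2 x v : diff_at h1 x -> diff_at h2 (h1 x) ->
  tangent_map A (h2 \o h1) x v = tangent_map A h2 (h1 x) (tangent_map A h1 x v).
Proof.
move=> H1 H2.
have [_ E] := @chart_diff_comp h1 h2 _ _ _ _ (mem_chart_at A x)
  (mem_chart_at A _) (mem_chart_at A _) H1 H2.
apply: (eq_trans (tangent_mapE (h2 \o h1) x v)); apply: (eq_trans (E v)).
apply: esym; apply: (eq_trans (tangent_mapE h2 (h1 x) _)).
exact: congr1 (tangent_mapE h1 x v).
Qed.

Lemma tangent_map_id x v : tangent_map A id x v = v.
Proof. by rewrite tangent_mapE chart_diff_id//; exact: mem_chart_at. Qed.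

Lemma tangent_map_iterK h hinv (k : nat) x v : cancel h hinv ->
  C1_map A h -> C1_map A hinv ->
  tangent_map A (iter k hinv) (iter k h x) (tangent_map A (iter k h) x v) = v.
Proof.
move=> hK Ch Chi.
have E : iter k hinv \o iter k h = id.
  apply/funext => y /=; elim: k => // k IH.
  by rewrite iterSr iterS hK IH.
have := tangent_map_comp v (diff_at_iter k x Ch) (diff_at_iter k (iter k h x) Chi).
by rewrite E => <-; exact: tangent_map_id.
Qed.

End Charts.

(** * Riemannian norms in charts *)

(* Unification must not unfold the choice hidden in the differential. *)
Local Opaque derive.diff.

Section InnerProd.
Variables (R : realType) (n : nat).
Implicit Types (G : 'M[R]_n) (u v : 'rV[R]_n).

Lemma inner_prodZl G a u v : inner_prod G (a *: u) v = a * inner_prod G u v.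
Proof. by rewrite /inner_prod -!scalemxAl mxE. Qed.

Lemma inner_prodZr G a u v : inner_prod G u (a *: v) = a * inner_prod G u v.
Proof. by rewrite /inner_prod linearZ /= -scalemxAr mxE. Qed.

Lemma inner_prod_suml G (I : Type) (s : seq I) (F : I -> 'rV[R]_n) v :
  inner_prod G (\sum_(i <- s) F i) v = \sum_(i <- s) inner_prod G (F i) v.
Proof. by rewrite /inner_prod !mulmx_suml summxE. Qed.

Lemma inner_prod_sumr G (I : Type) (s : seq I) (F : I -> 'rV[R]_n) u :
  inner_prod G u (\sum_(i <- s) F i) = \sum_(i <- s) inner_prod G u (F i).
Proof. by rewrite /inner_prod linear_sum /= mulmx_sumr summxE. Qed.

Lemma inner_prod_basis G (L : {linear 'rV[R]_n -> 'rV[R]_n}) v :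
  inner_prod G (L v) (L v) =
  \sum_(a < n) \sum_(b < n)
    v 0 a * v 0 b * inner_prod G (L (delta_mx 0 a)) (L (delta_mx 0 b)).
Proof.
rewrite {1 2}(row_sum_delta v) linear_sum inner_prod_suml.
apply: eq_bigr => a _; rewrite inner_prod_sumr; apply: eq_bigr => b _.
by rewrite !linearZ /= inner_prodZl inner_prodZr mulrA.
Qed.

End InnerProd.

Lemma sphere_compact (R : realType) n : compact [set v : 'rV[R]_n | `|v| = 1].
Proof.
apply: bounded_closed_compact.
  by exists 1; split => // y y1 v /= ->; exact: ltW.
have -> : [set v : 'rV[R]_n | `|v| = 1] =
   (Num.norm : 'rV[R]_n -> R) @^-1` [set t | t = 1] by [].
by apply: closed_comp => [y _|]; [exact: norm_continuous|exact: closed_eq].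
Qed.

Section NormEquiv.
Variables (R : realType) (n : nat) (M : metricType R) (A : atlas R n M).
Variable g : riemannian_metric A.
Local Notation V := 'rV[R]_n.

Let form (i : chart_index A) (x : M) (v : V) : R :=
  inner_prod (gram g x) (to_tangent i x v) (to_tangent i x v).

Let tangent_norm0 x : tangent_norm g x 0 = 0.
Proof. by rewrite /tangent_norm /inner_prod !mul0mx mxE sqrtr0. Qed.

Let form_gt0 (i : chart_index A) x (v : V) : chart_dom i x -> v != 0 -> 0 < form i x v.
Proof.
move=> di v0; apply: gram_posdef; apply: contra_neq v0 => E.
apply: (eq_trans (esym (to_tangentK v di))).
by apply: (eq_trans (congr1 _ E)); exact: linear0.
Qed.

Let formZ (i : chart_index A) x a (v : V) : form i x (a *: v) = a ^+ 2 * form i x v.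
Proof. by rewrite /form linearZ /= inner_prodZl inner_prodZr expr2 mulrA. Qed.

(** [gram] and [to_tangent] may each jump with the preferred chart. Their combination is a component
    of the metric in the fixed chart [i], hence continuous by the order zero case of
    [gram_smooth]. *)
Let coef_continuous (i : chart_index A) (a b : 'I_n) x : chart_dom i x ->
  {for x, continuous (fun z => inner_prod (gram g z)
     (to_tangent i z (delta_mx 0 a)) (to_tangent i z (delta_mx 0 b)) : R)}.
Proof.
move=> di.
have cx : (chart i @` chart_dom i) (chart i x) by exists x.
have cont := @gram_smooth _ _ _ _ g i (delta_mx 0 a) (delta_mx 0 b) 0%N _ cx.
pose G y : R := inner_prod (gram g (chart_inv i y))
  (to_preferred i y (delta_mx 0 a)) (to_preferred i y (delta_mx 0 b)).
pose T z : R := inner_prod (gram g z)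
  (to_tangent i z (delta_mx 0 a)) (to_tangent i z (delta_mx 0 b)).
have E z : chart_dom i z -> G (chart i z) = T z.
  by move=> dz; rewrite /G !to_preferredE// chartK.
have H : (G \o chart i) @ x --> G (chart i x).
  exact: continuous_comp (chart_continuous di) cont.
suff : T @ x --> T x by [].
rewrite -(E x di); apply: cvg_trans H; apply: near_eq_cvg.
have : \forall z \near x, chart_dom i z.
  by apply: open_nbhs_nbhs; split => //; exact: dom_open.
by apply: near_imp => z dz /=; rewrite E.
Qed.

Let form_continuous (i : chart_index A) x (v : V) : chart_dom i x ->
  {for (x, v), continuous (fun p : M * V => form i p.1 p.2 : R)}.
Proof.
move=> di.
have -> : (fun p : M * V => form i p.1 p.2) = (fun p : M * V =>
   \sum_(a < n) \sum_(b < n) p.2 0 a * p.2 0 b * inner_prod (gram g p.1)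
     (to_tangent i p.1 (delta_mx 0 a)) (to_tangent i p.1 (delta_mx 0 b))).
  by apply/funext => p; exact: inner_prod_basis.
have cc (a : 'I_n) : (fun p : M * V => p.2 0 a : R) @ (x, v) --> (v 0 a : R).
  have := @continuous_comp _ _ _ (snd : M * V -> V) (fun w : V => w 0 a : R) (x, v).
  by apply; [exact: cvg_snd|exact: coord_continuous].
apply: cvg_big => [|a _]; first exact: add_continuous.
apply: cvg_big => [|b _]; first exact: add_continuous.
apply: cvgM; first by apply: cvgM; exact: cc.
have := @continuous_comp _ _ _ (fst : M * V -> M) (fun z : M => _ : R) (x, v) _
  (@coef_continuous i a b x di).
by apply; exact: cvg_fst.
Qed.

(** The squared norm is continuous and positive on the compact product of [K] with the unit sphere,
    so it has a positive minimum and a maximum there; homogeneity does the rest. *)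
Lemma tangent_norm_equiv (i : chart_index A) (K : set M) : compact K -> K `<=` chart_dom i ->
  exists2 k : R, 0 < k & forall x v, K x ->
    `|v| <= k * tangent_norm g x (to_tangent i x v) /\
    tangent_norm g x (to_tangent i x v) <= k * `|v|.
Proof.
move=> cK Kd.
have cKS := compact_setX cK (@sphere_compact R n).
have cf : {within K `*` [set v : V | `|v| = 1],
    continuous (fun p : M * V => form i p.1 p.2 : R)}.
  apply: continuous_in_subspaceT => -[x v] /set_mem [/= Kx _].
  by apply: form_continuous; exact: Kd.
(* If the product is empty while [K x] holds, then [v] is zero, as a nonzero [v] could be normalized
   to a point of the sphere. *)
have [[p [Kp Sp]]|S0] := pselect (K `*` [set v : V | `|v| = 1] !=set0); last first.
  exists 1 => // x v Kx; suff -> : v = 0.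
    by rewrite linear0 tangent_norm0 normr0 mulr0.
  apply/eqP; apply: contra_notT S0 => v0; exists (x, `|v|^-1 *: v); split => //=.
  by rewrite normrZ normfV normr_id mulVf// normr_eq0.
have KS0 : K `*` [set v : V | `|v| = 1] !=set0 by exists p.
have [[x1 v1] /set_mem [/= Kx1 Sv1] maxf] := compact_EVT_max KS0 cKS cf.
have [[x0 v0] /set_mem [/= Kx0 Sv0] minf] := compact_EVT_min KS0 cKS cf.
have nz (v : V) : `|v| = 1 -> v != 0 by rewrite -normr_gt0 => ->.
have m0 : 0 < form i x0 v0 by apply: form_gt0; [exact: Kd|exact: nz].
have m1 : 0 < form i x1 v1 by apply: form_gt0; [exact: Kd|exact: nz].
set mu := form i x0 v0 in m0 minf; set nu := form i x1 v1 in m1 maxf.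
pose k := Num.max (Num.sqrt mu)^-1 (Num.sqrt nu).
exists k; first by rewrite lt_max sqrtr_gt0 m1 orbT.
move=> x v Kx.
have [->|vn0] := eqVneq v 0.
  by rewrite linear0 tangent_norm0 normr0 mulr0.
have v_gt0 : 0 < `|v| by rewrite normr_gt0.
pose w := `|v|^-1 *: v.
have Sw : `|w| = 1 by rewrite normrZ normfV normr_id mulVf// gt_eqF.
have tE : tangent_norm g x (to_tangent i x v) = `|v| * Num.sqrt (form i x w).
  rewrite /tangent_norm -/(form i x v).
  rewrite {1}(_ : v = `|v| *: w); last by rewrite scalerA mulfV ?scale1r// gt_eqF.
  by rewrite formZ sqrtrM ?sqr_ge0// sqrtr_sqr normr_id.
have Kw : (x, w) \in K `*` [set v : V | `|v| = 1] by apply: mem_set; split.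
have := minf _ Kw; have := maxf _ Kw; rewrite /= => H1 H2.
have s1 : Num.sqrt (form i x w) <= Num.sqrt nu by rewrite ler_sqrt// ltW.
have s2 : Num.sqrt mu <= Num.sqrt (form i x w).
  by rewrite ler_sqrt// (le_trans (ltW m0)).
have smu : 0 < Num.sqrt mu by rewrite sqrtr_gt0.
rewrite tE; split; last first.
  by rewrite mulrC ler_wpM2r// (le_trans s1)// le_max lexx orbT.
rewrite mulrCA ler_peMr//.
apply: (@le_trans _ _ ((Num.sqrt mu)^-1 * Num.sqrt (form i x w))).
  by rewrite mulrC ler_pdivlMr// mul1r.
by apply: ler_wpM2r; [exact: sqrtr_ge0|rewrite le_max lexx].
Qed.

End NormEquiv.

(** * Uniform control of finitely many charts *)

Section LocalUniform.
Variables (R : realType) (n : nat) (M : metricType R) (A : atlas R n M).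
Local Notation V := 'rV[R]_n.
Implicit Types (i j : chart_index A) (q x y : M) (e : R).

Lemma near_pair_ball (P : M -> Prop) x : (\forall q \near x, P q) ->
  exists2 d : R, 0 < d & forall q q', mdist x q <= d -> mdist q q' <= d -> P q'.
Proof.
move=> /nbhs_ballP [d /= d0 dP].
exists (d / 3); first by rewrite divr_gt0.
move=> q q' xq qq'; apply: dP; rewrite ballEmdist /=.
apply: (le_lt_trans (metric_triangle x q q')); lra.
Qed.

Lemma near_chart_dist i x e : chart_dom i x -> 0 < e ->
  \forall q \near x, `|chart i x - chart i q| <= e.
Proof.
move=> dx e0.
have H : chart i @ x --> chart i x by exact: chart_continuous.
by have /cvgrPdist_le/(_ e e0) := H.
Qed.

Lemma chart_ucont_at i x e : chart_dom i x -> 0 < e ->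
  \forall q \near x & r \near (0:R)^'+, forall q', mdist q q' <= r ->
    `|chart i q - chart i q'| <= e.
Proof.
move=> dx e0; have e2 : 0 < e / 2 by rewrite divr_gt0.
have H := near_chart_dist dx e2; have [d d0 H'] := near_pair_ball H.
near=> q r.
have rd : r <= d by near: r; exact: nbhs_right_le.
move=> q' qq'.
have H1 : `|chart i x - chart i q| <= e / 2 by near: q.
have H2 : `|chart i x - chart i q'| <= e / 2.
  apply: (H' q); first by near: q; exact: near_mdist.
  exact: (le_trans qq').
rewrite (splitr e) -(subrKA (chart i x)); apply: (le_trans (ler_normD _ _)).
by rewrite lerD// distrC.
Unshelve. all: by end_near. Qed.

Lemma chart_inv_ucont_at i x e : chart_dom i x -> 0 < e ->
  \forall q \near x & r \near (0:R)^'+, forall y : V, `|chart i q - y| <= r ->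
    mdist q (chart_inv i y) <= e /\ chart i (chart_inv i y) = y.
Proof.
move=> dx e0; have e2 : 0 < e / 2 by rewrite divr_gt0.
have B1 : nbhs (chart i x) [set y | mdist x (chart_inv i y) <= e / 2].
  have H := chart_inv_cvg dx.
  have Hn : nbhs x [set z | mdist x z <= e / 2] by exact: near_mdist.
  exact: (H _ Hn).
have B2 : nbhs (chart i x) (chart i @` chart_dom i).
  by apply: open_nbhs_nbhs; split; [exact: codom_open|exists x].
have /nbhs_ballP [d /= d0 dB] : nbhs (chart i x)
    ([set y | mdist x (chart_inv i y) <= e / 2] `&` (chart i @` chart_dom i)).
  exact: filterI.
have d2 : 0 < d / 2 by rewrite divr_gt0.
near=> q r => y qy.
have H1 : mdist x q <= e / 2 by near: q; exact: near_mdist.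
have H2 : `|chart i x - chart i q| <= d / 2 by near: q; exact: near_chart_dist.
have H3 : r < d / 2 by near: r; apply: nbhs_right_lt.
have [] : ([set y | mdist x (chart_inv i y) <= e / 2] `&` (chart i @` chart_dom i)) y.
  apply: dB; rewrite -ball_normE /= -(subrKA (chart i q)).
  apply: (le_lt_trans (ler_normD _ _)); rewrite (splitr d) ler_ltD//.
  exact: le_lt_trans H3.
move=> /= H4 [z dz zy]; rewrite -zy chartK// in H4 *; split => //.
apply: (le_trans (metric_triangle q x z)); rewrite (metric_sym q x).
by rewrite (splitr e) lerD.
Unshelve. all: by end_near. Qed.

Variable f : M -> M.
Hypothesis f1 : C1_map A f.

Let U i j := chart i @` (chart_dom i `&` f @^-1` chart_dom j).

Let U_open i j : open (U i j).
Proof.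
apply: chart_image_open; apply: open_comp; last exact: dom_open.
by move=> x _; case: f1 => + _; apply.
Qed.

Let near_diff i j x e : chart_dom i x -> chart_dom j (f x) -> 0 < e ->
  \forall q \near x, forall w : V,
    `|chart_diff f i j q w - chart_diff f i j x w| <= e * `|w|.
Proof.
move=> di dj e0; have [cf Cf] := f1.
have Ux : U i j (chart i x) by exists x.
have H := C1_diff_near (Cf i j) Ux e0.
have H2 : chart i @ x --> chart i x by exact: chart_continuous.
exact: H2 _ H.
Qed.

Lemma chart_diff_ucont_at i j x e : chart_dom i x -> chart_dom j (f x) -> 0 < e ->
  \forall q \near x & r \near (0:R)^'+, forall q', mdist q q' <= r ->
    forall w : V, `|chart_diff f i j q w - chart_diff f i j q' w| <= e * `|w|.
Proof.
move=> dx dj e0; have e2 : 0 < e / 2 by rewrite divr_gt0.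
have H := near_diff dx dj e2; have [d d0 H'] := near_pair_ball H.
near=> q r.
have rd : r <= d by near: r; exact: nbhs_right_le.
move=> q' qq' w.
have H1 : forall w : V, `|chart_diff f i j q w - chart_diff f i j x w| <= e / 2 * `|w|.
  by near: q.
have H2 : forall w : V, `|chart_diff f i j q' w - chart_diff f i j x w| <= e / 2 * `|w|.
  apply: (H' q); first by near: q; exact: near_mdist.
  exact: (le_trans qq').
rewrite -(subrKA (chart_diff f i j x w)); apply: (le_trans (ler_normD _ _)).
rewrite [X in _ <= X * _](splitr e) mulrDl; apply: lerD; first exact: H1.
rewrite distrC; exact: H2.
Unshelve. all: by end_near. Qed.

(** The constant is written [r^-1] so that enlarging it means shrinking [r], which is the form
    [finite_uniform] handles. *)
Lemma chart_diff_bounded_at i j x : chart_dom i x -> chart_dom j (f x) ->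
  \forall q \near x & r \near (0:R)^'+, forall w : V,
    `|chart_diff f i j q w| <= r^-1 * `|w|.
Proof.
move=> dx dj.
have [k k0 kP] : exists2 k, 0 < k & forall w : V, `|chart_diff f i j x w| <= k * `|w|.
  apply: linear_lipschitz; apply: diff_continuous.
  by have [_] := C1_diff_at x f1; apply.
have H := near_diff dx dj ltr01.
near=> q r => w.
have r0 : 0 < r by near: r; exact: nbhs_right_gt.
have H1 : forall w : V, `|chart_diff f i j q w - chart_diff f i j x w| <= 1 * `|w|.
  by near: q.
have rk : r < (1 + k)^-1 by near: r; apply: nbhs_right_lt; rewrite invr_gt0 addr_gt0.
rewrite -(subrK (chart_diff f i j x w) (chart_diff f i j q w)).
apply: (le_trans (ler_normD _ _)).
apply: (le_trans (lerD (H1 w) (kP w))); rewrite -mulrDl ler_wpM2r//.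
by rewrite -[1 + k]invrK lef_pV2 ?posrE ?invr_gt0 ?addr_gt0// ltW.
Unshelve. all: by end_near. Qed.

Lemma chart_strict_at i j x e : chart_dom i x -> chart_dom j (f x) -> 0 < e ->
  \forall q \near x & r \near (0:R)^'+, forall u v : V,
    `|u - chart i q| <= r -> `|v - chart i q| <= r ->
    `|in_charts f i j u - in_charts f i j v - chart_diff f i j q (u - v)|
      <= e * `|u - v|.
Proof.
move=> dx dj e0; have e2 : 0 < e / 2 by rewrite divr_gt0.
have H := near_diff dx dj e2; have [cf Cf] := f1.
have Ux : U i j (chart i x) by exists x.
have S := C1_strict (@U_open i j) (Cf i j) Ux e2.
have [r0 r00 Sr0] : exists2 r0 : R, 0 < r0 & forall u v,
   `|u - chart i x| <= r0 -> `|v - chart i x| <= r0 ->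
   `|in_charts f i j u - in_charts f i j v - chart_diff f i j x (u - v)|
      <= e / 2 * `|u - v|.
  near ((0:R)^'+) => r0; exists r0; first by near: r0; exact: nbhs_right_gt.
  by near: r0.
have r02 : 0 < r0 / 2 by rewrite divr_gt0.
near=> q r => u v uq vq.
have H1 : forall w : V, `|chart_diff f i j q w - chart_diff f i j x w| <= e / 2 * `|w|.
  by near: q.
have H2 : `|chart i x - chart i q| <= r0 / 2 by near: q; exact: near_chart_dist.
have rr : r < r0 / 2 by near: r; apply: nbhs_right_lt.
have B w : `|w - chart i q| <= r -> `|w - chart i x| <= r0.
  move=> wq; rewrite -(subrKA (chart i q)); apply: (le_trans (ler_normD _ _)).
  by rewrite (splitr r0) lerD// ?(le_trans wq (ltW rr))// distrC.
have := Sr0 u v (B _ uq) (B _ vq).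
set a := in_charts f i j u - in_charts f i j v; set w := u - v => H3.
rewrite -(subrKA (chart_diff f i j x w)).
apply: (le_trans (ler_normD _ _)); rewrite [X in _ <= X * _](splitr e) mulrDl.
apply: lerD; first exact: H3.
rewrite distrC; exact: H1.
Unshelve. all: by end_near. Qed.

End LocalUniform.

(* [compact_cover] would require a pointed type. *)
Lemma compact_finite_cover (T : choiceType) (X : topologicalType) (K : set X)
    (B : T -> set X) :
  compact K -> (forall x, K x -> exists i, nbhs x (B i)) ->
  exists D : {fset T}, forall x, K x -> exists2 i, i \in D & B i x.
Proof.
move=> /compact_near_coveringP cov HB.
(* The filter of all sufficiently large finite index sets: the covering property for it says that
   one finite set serves every point of [K]. *)
pose F : set_system {fset T} :=
  [set S | exists D0 : {fset T}, forall D : {fset T}, (D0 `<=` D)%fset -> S D].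
have FF : Filter F.
  split; first by exists fset0.
  - move=> S1 S2 [D1 H1] [D2 H2]; exists (D1 `|` D2)%fset => D.
    by rewrite fsubUset => /andP[/H1 ? /H2 ?].
  - by move=> S1 S2 S12 [D1 H1]; exists D1 => D /H1 /S12.
have [D HD] : F (fun D => K `<=` (fun x => exists2 i, i \in D & B i x)).
  apply: (cov _ F (fun D x => exists2 i, i \in D & B i x)) => x Kx.
  have [i Bi] := HB x Kx.
  exists (B i, [set D : {fset T} | i \in D]).
    split => //; exists [fset i]%fset => D.
    by rewrite fsub1set.
  by move=> [y D] /= [By iD]; exists i.
by exists D; apply: HD.
Qed.

Section UniformAtlas.
Variables (R : realType) (n : nat) (M : metricType R) (A : atlas R n M).
Variables (g : riemannian_metric A) (f : M -> M).
Local Notation V := 'rV[R]_n.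

(* [c] selects finitely many charts, the chart [c p] being under uniform       *)
(* control on the closed ball of radius [rho] around [p].                      *)
Record uniform_atlas (c : M -> chart_index A) (rho k : R) : Prop := {
  ua_rho_gt0 : 0 < rho;
  ua_k_gt0 : 0 < k;
  ua_dom : forall p q, mdist p q <= rho -> chart_dom (c p) q;
  ua_chart : forall e, 0 < e -> \forall r \near (0:R)^'+, forall p q q',
    mdist p q <= rho -> mdist q q' <= r ->
    `|chart (c p) q - chart (c p) q'| <= e;
  ua_chart_inv : forall e, 0 < e -> \forall r \near (0:R)^'+, forall p q y,
    mdist p q <= rho -> `|chart (c p) q - y| <= r ->
    mdist q (chart_inv (c p) y) <= e /\ chart (c p) (chart_inv (c p) y) = y;
  ua_strict : forall e, 0 < e -> \forall r \near (0:R)^'+, forall p p' q,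
    mdist p q <= rho -> mdist p' (f q) <= rho -> forall u v : V,
    `|u - chart (c p) q| <= r -> `|v - chart (c p) q| <= r ->
    `|in_charts f (c p) (c p') u - in_charts f (c p) (c p') v
       - chart_diff f (c p) (c p') q (u - v)| <= e * `|u - v|;
  ua_diff_ucont : forall e, 0 < e -> \forall r \near (0:R)^'+, forall p p' q q',
    mdist p q <= rho -> mdist p' (f q) <= rho -> mdist q q' <= r -> forall w : V,
    `|chart_diff f (c p) (c p') q w - chart_diff f (c p) (c p') q' w| <= e * `|w|;
  ua_diff_bound : forall p p' q (w : V),
    mdist p q <= rho -> mdist p' (f q) <= rho ->
    `|chart_diff f (c p) (c p') q w| <= k * `|w|;
  ua_norm : forall p q (v : V), mdist p q <= rho ->
    `|v| <= k * tangent_norm g q (to_tangent (c p) q v) /\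
    tangent_norm g q (to_tangent (c p) q v) <= k * `|v| }.

(** A Lebesgue number argument: balls of radius [d x] cover, while the closed balls [K x] of radius
    [d x + d x] still lie in a chart; so points within [rho <= d (c p)] of [p] stay in [K (c p)]. *)
Lemma finite_chart_cover : compact [set: M] ->
  exists (D : {fset M}) (K : M -> set M) (c : M -> M) (rho : R),
    [/\ 0 < rho, forall p, c p \in D,
        forall x, compact (K x) /\ K x `<=` chart_dom (chart_at A x) &
        forall p q, mdist p q <= rho -> K (c p) q].
Proof.
move=> cM.
have ballsub x : exists d : R, 0 < d /\
    forall y, mdist x y <= d + d -> chart_dom (chart_at A x) y.
  have : \forall y \near x, chart_dom (chart_at A x) y.
    by apply: open_nbhs_nbhs; split; [exact: dom_open|exact: mem_chart_at].
  move=> /near_mdist_sub H; near ((0:R)^'+) => r.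
  have r0 : 0 < r by near: r; exact: nbhs_right_gt.
  exists (r / 2); split; first by rewrite divr_gt0.
  by move=> y; rewrite -splitr; move: y; near: r.
have [d dP] := choice ballsub.
pose B x := [set y | mdist x y < d x].
pose K x := [set y | mdist x y <= d x + d x].
have [D cov] : exists D : {fset M}, forall p, [set: M] p -> exists2 x, x \in D & B x p.
  apply: compact_finite_cover cM _ => p _; exists p.
  apply: open_nbhs_nbhs; split; first exact: open_mdist_lt.
  by rewrite /B /= mdistxx; have [] := dP p.
have covc p : exists x, x \in D /\ B x p by have [x xD Bx] := cov p I; exists x.
have [c cP] := choice covc.
have : \forall r \near (0:R)^'+, (\bigcap_(x in [set` D]) [set r | r <= d x]) r.
  by apply: filter_bigI => x _; apply: nbhs_right_le; have [] := dP x.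
move=> Hr; near ((0:R)^'+) => r.
have r0 : 0 < r by near: r; exact: nbhs_right_gt.
have rd : (\bigcap_(x in [set` D]) [set r | r <= d x]) r by near: r.
exists D, K, c, r; split => //.
- by move=> p; have [] := cP p.
- move=> x; split; last by move=> y; have [_] := dP x; apply.
  by apply: subclosed_compact cM _ => //; exact: closed_mdist_le.
- move=> p q pq; have [cD Bp] := cP p; have := rd _ cD => /= rdc.
  rewrite /K /=; apply: (le_trans (metric_triangle _ p _)).
  apply: lerD; [exact: ltW|exact: le_trans pq rdc].
Unshelve. all: by end_near. Qed.

Lemma uniform_atlas_exists : compact [set: M] -> C1_map A f ->
  exists c rho k, uniform_atlas c rho k.
Proof.
move=> cM f1; have [D [K [c0 [rho [rho0 c0D KP c0K]]]]] := finite_chart_cover cM.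
have cf : continuous f by case: f1.
pose c p := chart_at A (c0 p).
have cK x : compact (K x) by case: (KP x).
have Kd x q : K x q -> chart_dom (chart_at A x) q by case: (KP x) => _; apply.
have clK x : closed (K x) by apply: compact_closed; [exact: metric_hausdorff|].
(* [one] globalizes bounds concerning a single chart; [two] those relating a chart at [q] to a chart
   at [f q], over the finite set of pairs of charts. *)
have one (P : R -> M -> M -> Prop) :
   (forall x q0, K x q0 -> \forall q \near q0 & r \near (0:R)^'+, P r x q) ->
   \forall r \near (0:R)^'+, forall p q, mdist p q <= rho -> P r (c0 p) q.
  move=> HP.
  have : \forall r \near (0:R)^'+, forall i q, i \in D -> K i q -> P r i q.
    apply: finite_uniform => // i q0 _ Kq.
    by apply: filterS (HP i q0 Kq) => -[q r] /= Hp _.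
  by apply: filterS => r Hr p q pq; apply: Hr; [exact: c0D|exact: c0K].
have two (P : R -> M -> M -> M -> Prop) :
   (forall x x' q0, K x q0 -> K x' (f q0) ->
     \forall q \near q0 & r \near (0:R)^'+, P r x x' q) ->
   \forall r \near (0:R)^'+, forall p p' q, mdist p q <= rho ->
     mdist p' (f q) <= rho -> P r (c0 p) (c0 p') q.
  move=> HP; pose K2 (xx : M * M) := K xx.1 `&` f @^-1` K xx.2.
  have : \forall r \near (0:R)^'+, forall (xx : M * M) q, xx \in (D `*` D)%fset ->
      K2 xx q -> P r xx.1 xx.2 q.
    apply: finite_uniform => [xx _|[x x'] q0 _ [/= Kq Kq']].
      apply: compact_closedI => //.
      by apply: closed_comp => // y _; exact: cf.
    by apply: filterS (HP x x' q0 Kq Kq') => -[q r] /= Hp _.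
  apply: filterS => r Hr p p' q pq pq'.
  apply: (Hr (c0 p, c0 p')); first by rewrite in_fsetM /= !c0D.
  by split; exact: c0K.
have [k1 [k10 Hk1]] : exists r : R, 0 < r /\ forall p p' q, mdist p q <= rho ->
    mdist p' (f q) <= rho ->
    forall w : V, `|chart_diff f (c p) (c p') q w| <= r^-1 * `|w|.
  have H := two (fun r x x' q => forall w : V,
    `|chart_diff f (chart_at A x) (chart_at A x') q w| <= r^-1 * `|w|).
  have H1 := H (fun x x' q Kq Kq' => chart_diff_bounded_at f1 (Kd _ _ Kq) (Kd _ _ Kq')).
  near ((0:R)^'+) => r; exists r; split; first by near: r; exact: nbhs_right_gt.
  by near: r.
have [k2 [k20 Hk2]] : exists r : R, 0 < r /\ forall p q, mdist p q <= rho ->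
    forall v : V, `|v| <= r^-1 * tangent_norm g q (to_tangent (c p) q v) /\
      tangent_norm g q (to_tangent (c p) q v) <= r^-1 * `|v|.
  have kx x : exists k : R, 0 < k /\ forall q v, K x q ->
     `|v| <= k * tangent_norm g q (to_tangent (chart_at A x) q v) /\
      tangent_norm g q (to_tangent (chart_at A x) q v) <= k * `|v|.
    have [k k0 Hk] := tangent_norm_equiv g (cK x) (Kd x).
    by exists k.
  have [kk kkP] := choice kx.
  have : \forall r \near (0:R)^'+, (\bigcap_(x in [set` D]) [set r | r <= (kk x)^-1]) r.
    apply: filter_bigI => x _; apply: nbhs_right_le; rewrite invr_gt0.
    by have [] := kkP x.
  move=> Hr; near ((0:R)^'+) => r.
  have r0 : 0 < r by near: r; exact: nbhs_right_gt.
  exists r; split => // p q pq v.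
  have rd : (\bigcap_(x in [set` D]) [set r | r <= (kk x)^-1]) r by near: r.
  have /= rk := rd _ (c0D p).
  have [kk0 /(_ q v (c0K _ _ pq)) [H1 H2]] := kkP (c0 p).
  have kr : kk (c0 p) <= r^-1.
    by rewrite -[kk _]invrK lef_pV2 ?posrE ?invr_gt0.
  split.
    by apply: (le_trans H1); apply: ler_wpM2r => //; exact: sqrtr_ge0.
  by apply: (le_trans H2); apply: ler_wpM2r.
exists c, rho, (Num.max k1^-1 k2^-1); split => //.
- by rewrite lt_max invr_gt0 k10.
- by move=> p q pq; apply: Kd; exact: c0K.
- move=> e e0; have H := one (fun r x q => forall q', mdist q q' <= r ->
    `|chart (chart_at A x) q - chart (chart_at A x) q'| <= e).
  have := H (fun x q Kq => chart_ucont_at (Kd _ _ Kq) e0).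
  by apply: filterS => r Hr p q q' pq; exact: Hr.
- move=> e e0; have H := one (fun r x q => forall y,
    `|chart (chart_at A x) q - y| <= r ->
    mdist q (chart_inv (chart_at A x) y) <= e /\
    chart (chart_at A x) (chart_inv (chart_at A x) y) = y).
  have := H (fun x q Kq => chart_inv_ucont_at (Kd _ _ Kq) e0).
  by apply: filterS => r Hr p q y pq; exact: Hr.
- move=> e e0; have H := two (fun r x x' q => forall u v : V,
    `|u - chart (chart_at A x) q| <= r -> `|v - chart (chart_at A x) q| <= r ->
    `|in_charts f (chart_at A x) (chart_at A x') u
      - in_charts f (chart_at A x) (chart_at A x') v
       - chart_diff f (chart_at A x) (chart_at A x') q (u - v)| <= e * `|u - v|).
  exact: H (fun x x' q Kq Kq' => chart_strict_at f1 (Kd _ _ Kq) (Kd _ _ Kq') e0).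
- move=> e e0; have H := two (fun r x x' q => forall q', mdist q q' <= r ->
    forall w : V, `|chart_diff f (chart_at A x) (chart_at A x') q w
       - chart_diff f (chart_at A x) (chart_at A x') q' w| <= e * `|w|).
  have := H (fun x x' q Kq Kq' => chart_diff_ucont_at f1 (Kd _ _ Kq) (Kd _ _ Kq') e0).
  by apply: filterS => r Hr p p' q q' pq pq'; exact: Hr.
- move=> p p' q w pq pq'; apply: (le_trans (Hk1 _ _ _ pq pq' w)).
  by apply: ler_wpM2r => //; rewrite le_max lexx.
- move=> p q v pq; have [H1 H2] := Hk2 _ _ pq v; split.
    apply: (le_trans H1); apply: ler_wpM2r; first exact: sqrtr_ge0.
    by rewrite le_max lexx orbT.
  by apply: (le_trans H2); apply: ler_wpM2r => //; rewrite le_max lexx orbT.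
Unshelve. all: by end_near. Qed.

End UniformAtlas.

(** * The estimate along hyperbolic orbits *)

(** Unlike [delta_chain], this allows length zero, which makes concatenation and padding uniform. *)
Definition pseudo_orbit (R : realType) (X : metricType R) (Z : set X)
    (f : X -> X) (delta : R) (k : nat) (x : nat -> X) : Prop :=
  (forall i, (i <= k)%N -> Z (x i)) /\
  (forall i, (i < k)%N -> mdist (f (x i)) (x i.+1) <= delta).

Section MetricDynamics.
Variables (R : realType) (M : metricType R) (f : M -> M).
Hypotheses (cM : compact [set: M]) (cf : continuous f).

Lemma compact_ucont e : 0 < e ->
  exists2 d : R, 0 < d & forall x y, mdist x y <= d -> mdist (f x) (f y) <= e.
Proof.
move=> e0; have e2 : 0 < e / 2 by rewrite divr_gt0.
have H : forall (i : bool) q0, i \in [fset true]%fset -> [set: M] q0 ->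
    \forall q \near q0 & r \near (0:R)^'+, [set: M] q ->
      forall y, mdist q y <= r -> mdist (f q) (f y) <= e.
  move=> i q0 _ _.
  have : \forall q \near q0, mdist (f q0) (f q) <= e / 2.
    have Hn : nbhs (f q0) [set z | mdist (f q0) z <= e / 2] by exact: near_mdist.
    exact: (cf Hn).
  move=> /near_pair_ball [d d0 H].
  near=> q r.
  have H1 : mdist q0 q <= d by near: q; exact: near_mdist.
  have H2 : r <= d by near: r; exact: nbhs_right_le.
  move=> _ y qy.
  apply: (le_trans (metric_triangle _ (f q0) _)).
  rewrite (splitr e) lerD//; last by apply: (H q); rewrite ?(le_trans qy).
  by rewrite metric_sym; apply: (H q0); rewrite ?mdistxx// ltW.
have := @finite_uniform _ _ _ _ (fun _ => [set: M]) (fun r _ q =>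
  forall y, mdist q y <= r -> mdist (f q) (f y) <= e) (fun _ _ => cM) H.
move=> H1; near ((0:R)^'+) => r.
have r0 : 0 < r by near: r; exact: nbhs_right_gt.
exists r => // x y.
have Hr : forall (i : bool) q, i \in [fset true]%fset -> [set: M] q ->
   forall y, mdist q y <= r -> mdist (f q) (f y) <= e by near: r.
by apply: (Hr true) => //; rewrite in_fset1.
Unshelve. all: by end_near. Qed.

Lemma pseudo_orbit_follows (Z : set M) (N : nat) (e : R) : 0 < e ->
  exists2 d : R, 0 < d & forall x, pseudo_orbit Z f d N x ->
    forall l, (l <= N)%N -> mdist (x l) (iter l f (x 0%N)) <= e.
Proof.
elim: N e => [|N IH] e e0.
  by exists 1 => // x _ l; rewrite leqn0 => /eqP ->; rewrite mdistxx ltW.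
have e2 : 0 < e / 2 by rewrite divr_gt0.
have [d1 d10 H1] := compact_ucont e2.
have em : 0 < Num.min d1 e by rewrite lt_min d10.
have [d2 d20 H2] := IH _ em.
exists (Num.min d2 (e / 2)); first by rewrite lt_min d20.
move=> x [Zx xs] l lN.
have xs' i : (i < N)%N -> mdist (f (x i)) (x i.+1) <= d2.
  move=> iN; apply: (le_trans (xs i _)); first by rewrite ltnS ltnW.
  by rewrite ge_min lexx.
have H3 i : (i <= N)%N -> mdist (x i) (iter i f (x 0%N)) <= Num.min d1 e.
  by apply: H2; split => // j jN; apply: Zx; rewrite ltnW.
move: lN; rewrite leq_eqVlt => /orP[/eqP ->|]; last first.
  by rewrite ltnS => /H3 /le_trans; apply; rewrite ge_min lexx orbT.
apply: (le_trans (metric_triangle _ (f (x N)) _)); rewrite (splitr e) lerD//.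
  rewrite metric_sym; apply: (le_trans (xs N _)) => //.
  by rewrite ge_min lexx orbT.
rewrite iterS; apply: H1; apply: (le_trans (H3 N _)) => //.
by rewrite ge_min lexx.
Qed.

End MetricDynamics.

Section LinearEstimate.
Variables (R : realType) (n : nat) (M : metricType R) (A : atlas R n M).
Variables (g : riemannian_metric A) (f finv : M -> M).
Variables (c : M -> chart_index A) (rho k : R).
Local Notation V := 'rV[R]_n.

Hypothesis fK : cancel f finv.
Hypotheses (f1 : C1_map A f) (finv1 : C1_map A finv).
Hypothesis UA : uniform_atlas g f c rho k.

(** The charts are attached to points [p l] merely near the orbit of [q]: later [p] is a
    pseudo-orbit starting at [q], and the same charts serve for both. *)
Definition linear_orbit (q : M) (p : nat -> M) (N : nat) (y : nat -> V) :=
  forall l, (l < N)%N ->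
    y l.+1 = chart_diff f (c (p l)) (c (p l.+1)) (iter l f q) (y l).

Definition near_orbit (q : M) (p : nat -> M) (N : nat) :=
  forall l, (l <= N)%N -> mdist (p l) (iter l f q) <= rho.

Lemma linear_orbit_tangent q p N y : near_orbit q p N -> linear_orbit q p N y ->
  forall l, (l <= N)%N ->
    to_tangent (c (p l)) (iter l f q) (y l) =
    tangent_map A (iter l f) q (to_tangent (c (p 0%N)) q (y 0%N)).
Proof.
move=> pq yl; elim=> [_|l IH lN].
  by apply: esym; exact: tangent_map_id.
rewrite (yl _ lN).
have E1 := @to_tangent_diff _ _ _ A f (c (p l)) (c (p l.+1)) (iter l f q) (y l)
  (C1_diff_at _ f1) (ua_dom UA (pq _ (ltnW lN))) (ua_dom UA (pq _ lN)).
apply: (eq_trans E1).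
apply: (eq_trans (congr1 (tangent_map A f (iter l f q)) (IH (ltnW lN)))).
apply: esym.
exact: (@tangent_map_comp _ _ _ A (iter l f) f q _ (diff_at_iter l q f1)
  (C1_diff_at _ f1)).
Qed.

Variables (C : set M) (Es Eu : M -> {vspace V}) (c0 lambda : R).
Hypotheses (c00 : 0 < c0) (lambda01 : 0 < lambda < 1).
Hypothesis fC : forall x, C x -> C (f x).
Hypothesis split_full : forall x, C x -> (Es x + Eu x)%VS = fullv.
Hypothesis Es_inv : forall x, C x -> (tangent_map A f x @: Es x)%VS = Es (f x).
Hypothesis Eu_inv : forall x, C x -> (tangent_map A f x @: Eu x)%VS = Eu (f x).
Hypothesis Es_contract : forall x, C x -> forall (j : nat) v, v \in Es x ->
  tangent_norm g (iter j f x) (tangent_map A (iter j f) x v)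
    <= c0 * lambda ^+ j * tangent_norm g x v.
Hypothesis Eu_contract : forall x, C x -> forall (j : nat) v, v \in Eu x ->
  tangent_norm g (iter j finv x) (tangent_map A (iter j finv) x v)
    <= c0 * lambda ^+ j * tangent_norm g x v.

Let iterC q l : C q -> C (iter l f q).
Proof. by move=> Cq; elim: l => //= l; exact: fC. Qed.

Lemma linear_orbit_mem (E : M -> {vspace V}) q p N y :
  (forall x, C x -> (tangent_map A f x @: E x)%VS = E (f x)) ->
  C q -> near_orbit q p N -> linear_orbit q p N y ->
  to_tangent (c (p 0%N)) q (y 0%N) \in E q ->
  forall l, (l <= N)%N -> to_tangent (c (p l)) (iter l f q) (y l) \in E (iter l f q).
Proof.
move=> Einv Cq pq yl y0; elim=> [//|l IH lN].
rewrite (yl _ lN).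
have E1 := @to_tangent_diff _ _ _ A f (c (p l)) (c (p l.+1)) (iter l f q) (y l)
  (C1_diff_at _ f1) (ua_dom UA (pq _ (ltnW lN))) (ua_dom UA (pq _ lN)).
have := IH (ltnW lN); move/(memv_img (tangent_map A f (iter l f q))).
rewrite (Einv _ (iterC l Cq)) => H.
exact: (@eq_ind_r _ _ (fun z => z \in E (iter l.+1 f q)) H _ E1).
Qed.

(** The factor [k ^+ 2] is the cost of exchanging coordinate norm and Riemannian norm at both
    ends. *)
Lemma linear_orbit_stable q p N y : C q -> near_orbit q p N ->
  linear_orbit q p N y -> to_tangent (c (p 0%N)) q (y 0%N) \in Es q ->
  `|y N| <= k ^+ 2 * c0 * lambda ^+ N * `|y 0%N|.
Proof.
move=> Cq pq yl y0; have k0 := ua_k_gt0 UA.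
have [H1 _] := ua_norm UA (y N) (pq N (leqnn N)).
have [_ H2] := ua_norm UA (y 0%N) (pq 0%N (leq0n N)).
have H3 := Es_contract Cq N y0.
apply: (le_trans H1); rewrite (linear_orbit_tangent pq yl (leqnn N)).
have B0 : 0 < c0 * lambda ^+ N.
  by rewrite mulr_gt0// exprn_gt0//; case/andP: lambda01.
have -> : k ^+ 2 * c0 * lambda ^+ N * `|y 0%N| =
    k * (c0 * lambda ^+ N * (k * `|y 0%N|)) by ring.
by rewrite ler_pM2l//; apply: (le_trans H3); rewrite ler_pM2l.
Qed.

(** The contraction of [Eu] under [finv] is applied at the end of the segment, and
    [tangent_map_iterK] carries the vector back to its start. *)
Lemma linear_orbit_unstable q p N y : C q -> near_orbit q p N ->
  linear_orbit q p N y -> to_tangent (c (p 0%N)) q (y 0%N) \in Eu q ->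
  `|y 0%N| <= k ^+ 2 * c0 * lambda ^+ N * `|y N|.
Proof.
move=> Cq pq yl y0; have k0 := ua_k_gt0 UA.
have [H1 _] := ua_norm UA (y 0%N) (pq 0%N (leq0n N)).
have [_ H2] := ua_norm UA (y N) (pq N (leqnn N)).
have yN := linear_orbit_mem Eu_inv Cq pq yl y0 (leqnn N).
have H3 := Eu_contract (iterC N Cq) N yN.
have E2 := eq_trans (congr1 (tangent_map A (iter N finv) (iter N f q))
  (linear_orbit_tangent pq yl (leqnn N))) (tangent_map_iterK N q _ fK f1 finv1).
have E3 : iter N finv (iter N f q) = q.
  by elim: (N) => // l IH; rewrite iterSr iterS fK IH.
rewrite [X in tangent_norm _ X _ <= _]E3 [X in tangent_norm _ _ X <= _]E2 in H3.
apply: (le_trans H1).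
have B0 : 0 < c0 * lambda ^+ N.
  by rewrite mulr_gt0// exprn_gt0//; case/andP: lambda01.
have -> : k ^+ 2 * c0 * lambda ^+ N * `|y N| =
    k * (c0 * lambda ^+ N * (k * `|y N|)) by ring.
by rewrite ler_pM2l//; apply: (le_trans H3); rewrite ler_pM2l.
Qed.

End LinearEstimate.

Section Estimate.
Variables (R : realType) (n : nat) (M : metricType R) (A : atlas R n M).
Variables (g : riemannian_metric A) (f finv : M -> M).
Variables (c : M -> chart_index A) (rho k : R).
Local Notation V := 'rV[R]_n.

Fixpoint linear_iter (q : M) (p : nat -> M) (y : V) (l : nat) : V :=
  if l is l'.+1 then
    chart_diff f (c (p l')) (c (p l)) (iter l' f q) (linear_iter q p y l')
  else y.

Variables (C : set M).
Hypothesis fK : cancel f finv.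
Hypotheses (f1 : C1_map A f) (finv1 : C1_map A finv).
Hypothesis UA : uniform_atlas g f c rho k.
Hypothesis hypC : hyperbolic_set g f finv C.

Let fC x : C x -> C (f x).
Proof. by case: hypC => _ E _ Cx; rewrite -E; exists x. Qed.

Let k_gt0 : 0 < k. Proof. exact: ua_k_gt0 UA. Qed.

(** In units of [w], the accumulated error obeys the recursion e -> k e + 1: old errors grow by at
    most [k] and each step adds one. *)
Lemma linear_error q p N (v : nat -> V) y w : near_orbit f rho q p N -> v 0%N = y -> 0 <= w ->
  (forall l, (l < N)%N ->
    `|v l.+1 - chart_diff f (c (p l)) (c (p l.+1)) (iter l f q) (v l)| <= w) ->
  forall l, (l <= N)%N -> `|v l - linear_iter q p y l| <= iter l (fun e => k * e + 1) 0 * w.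
Proof.
move=> pq v0 w0 vw; elim=> [_|l IH lN].
  by rewrite /= v0 subrr normr0 mul0r.
rewrite iterS [linear_iter _ _ _ l.+1]/=.
set L := chart_diff f (c (p l)) (c (p l.+1)) (iter l f q).
have H1 : `|L (v l) - L (linear_iter q p y l)| <=
    k * (iter l (fun e => k * e + 1) 0 * w).
  rewrite -linearB; apply: (@le_trans _ _ (k * `|v l - linear_iter q p y l|)).
    by apply: (ua_diff_bound UA) (pq _ (ltnW lN)) (pq _ lN).
  by rewrite ler_pM2l//; exact: IH (ltnW lN).
rewrite -(subrKA (L (v l))); apply: (le_trans (ler_normD _ _)).
have := vw l lN; rewrite -/L => H2.
apply: (le_trans (lerD H2 H1)).
by rewrite mulrDl mul1r mulrA addrC.
Qed.

(** Split [v 0] into a stable and an unstable vector and let [s], [u] be their linear orbits. Each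
    half of the window contracts [s] forwards and [u] backwards by 1/16. The triangle inequality
    bounds [s] at time 0 by [v] and [u], and [u] at time [m + m] by [v], [s] and the accumulated
    error. These inequalities form a closed system that bounds the middle value by the two end
    values of [v]. *)
Lemma orbit_estimate : exists (m : nat) (K : R), 0 < K /\
  forall q p, C q -> near_orbit f rho q p (m + m) ->
  forall (v : nat -> V) w X, 0 <= w -> `|v 0%N| <= X -> `|v (m + m)%N| <= X ->
  (forall l, (l < m + m)%N ->
    `|v l.+1 - chart_diff f (c (p l)) (c (p l.+1)) (iter l f q) (v l)| <= w) ->
  `|v m| <= X / 4 + K * w.
Proof.
have [_ _ [Es [Eu [c0 [lambda [c00 l01 H]]]]]] := hypC.
have l0 : 0 < lambda by case/andP: l01.
have [m mP] : exists m, k ^+ 2 * c0 * lambda ^+ m <= 1 / 16.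
  have k2 : 0 < k ^+ 2 * c0 by rewrite mulr_gt0// exprn_gt0.
  have : (fun j => lambda ^+ j) @ \oo --> (0:R).
    by apply: cvg_expr; rewrite ger0_norm ?ltW//; case/andP: l01.
  move=> /cvgrPdist_le/(_ ((1 / 16) / (k ^+ 2 * c0))) []; first by rewrite divr_gt0.
  move=> m _ /(_ m (leqnn m)); rewrite sub0r normrN ger0_norm; last first.
    by rewrite exprn_ge0 ?ltW.
  by rewrite ler_pdivlMr// mulrC => ?; exists m.
pose E l := iter l (fun e : R => k * e + 1) 0.
have E0 l : 0 <= E l.
  by elim: l => //= l IH; rewrite addr_ge0// mulr_ge0// ltW.
exists m, (E m + E (m + m)%N + 1); split; first by rewrite ltr_wpDl// addr_ge0.
move=> q p Cq pq v w X w0 v0X v2X vw.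
have [splitq _ _ _ _] := H q Cq; have [spl _] := splitq.
have dq : chart_dom (c (p 0%N)) q by apply: (ua_dom UA); exact: (pq 0%N).
have : to_tangent (c (p 0%N)) q (v 0%N) \in (Es q + Eu q)%VS by rewrite spl memvf.
move=> /memv_addP [s' s'E [u' u'E Esu]].
pose s0 := chart_diff id (chart_at A q) (c (p 0%N)) q s'.
pose u0 := chart_diff id (chart_at A q) (c (p 0%N)) q u'.
have Ts0 : to_tangent (c (p 0%N)) q s0 = s' by exact: to_tangentVK.
have Tu0 : to_tangent (c (p 0%N)) q u0 = u' by exact: to_tangentVK.
have v0E : v 0%N = s0 + u0.
  apply: (eq_trans (esym (to_tangentK (v 0%N) dq))).
  by apply: (eq_trans (congr1 _ Esu)); exact: linearD.
pose s := linear_iter q p s0; pose u := linear_iter q p u0.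
have qC l : C (iter l f q) by elim: l => //= l; exact: fC.
have ls N : linear_orbit f c q p N s by [].
have lu N : linear_orbit f c q p N u by [].
have mm : (m <= m + m)%N by rewrite leq_addr.
have pqm : near_orbit f rho q p m by move=> l lm; apply: pq; exact: leq_trans lm mm.
have pq' : near_orbit f rho (iter m f q) (fun l => p (m + l)%N) m.
  by move=> l lm; rewrite -iterD [(l + m)%N]addnC; apply: pq; rewrite leq_add2l.
have shift y : linear_orbit f c q p (m + m) y ->
    linear_orbit f c (iter m f q) (fun l => p (m + l)%N) m (fun l => y (m + l)%N).
  move=> Hy l lm; rewrite !addnS -iterD [(l + m)%N]addnC; apply: Hy.
  by rewrite ltn_add2l.
have Esinv x : C x -> (tangent_map A f x @: Es x)%VS = Es (f x).
  by move=> Cx; have [] := H x Cx.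
have Euinv x : C x -> (tangent_map A f x @: Eu x)%VS = Eu (f x).
  by move=> Cx; have [] := H x Cx.
have Escon x : C x -> forall (j : nat) v, v \in Es x ->
  tangent_norm g (iter j f x) (tangent_map A (iter j f) x v)
    <= c0 * lambda ^+ j * tangent_norm g x v by move=> Cx; have [] := H x Cx.
have Eucon x : C x -> forall (j : nat) v, v \in Eu x ->
  tangent_norm g (iter j finv x) (tangent_map A (iter j finv) x v)
    <= c0 * lambda ^+ j * tangent_norm g x v by move=> Cx; have [] := H x Cx.
have s0E : to_tangent (c (p 0%N)) q (s 0%N) \in Es q by rewrite [s 0%N]/= Ts0.
have u0E : to_tangent (c (p 0%N)) q (u 0%N) \in Eu q by rewrite [u 0%N]/= Tu0.
have smE := linear_orbit_mem f1 UA fC Esinv Cq pqm (ls m) s0E (leqnn m).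
have umE := linear_orbit_mem f1 UA fC Euinv Cq pqm (lu m) u0E (leqnn m).
have sm'E : to_tangent (c (p (m + 0)%N)) (iter m f q) (s (m + 0)%N) \in Es (iter m f q).
  by rewrite addn0.
have um'E : to_tangent (c (p (m + 0)%N)) (iter m f q) (u (m + 0)%N) \in Eu (iter m f q).
  by rewrite addn0.
have small (a b : R) : 0 <= b -> a <= k ^+ 2 * c0 * lambda ^+ m * b -> a <= b / 16.
  move=> b0 /le_trans; apply; rewrite [b / 16]mulrC -[16^-1]mul1r.
  exact: ler_wpM2r.
have b1 := linear_orbit_stable f1 UA c00 l01 Escon Cq pqm (ls m) s0E.
have b2 := linear_orbit_unstable fK f1 finv1 UA c00 l01 fC Euinv Eucon Cq pqm (lu m) u0E.
have b3 := linear_orbit_stable f1 UA c00 l01 Escon (qC m) pq' (shift _ (ls _)) sm'E.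
have b4 := linear_orbit_unstable fK f1 finv1 UA c00 l01 fC Euinv Eucon (qC m) pq'
  (shift _ (lu _)) um'E.
have {}b1 := small _ _ (normr_ge0 _) b1; have {}b2 := small _ _ (normr_ge0 _) b2.
have {}b3 := small _ _ (normr_ge0 _) b3; have {}b4 := small _ _ (normr_ge0 _) b4.
have lin l : linear_iter q p (v 0%N) l = s l + u l.
  elim: l => [|l IH]; first exact: v0E.
  by rewrite [LHS]/= IH linearD.
have er := linear_error pq (erefl (v 0%N)) w0 vw.
have e1 := er m mm; have e2 := er (m + m)%N (leqnn _).
rewrite lin -/(E _) in e1; rewrite lin -/(E _) in e2.
rewrite addn0 in b3 b4; rewrite [s 0%N]/= in b1; rewrite [u 0%N]/= in b2.
have t1 : `|v m| <= `|v m - (s m + u m)| + (`|s m| + `|u m|).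
  rewrite -{1}(subrK (s m + u m) (v m)); apply: (le_trans (ler_normD _ _)).
  by rewrite lerD2l ler_normD.
have t2 : `|u (m + m)%N| <= `|v (m + m)%N|
    + `|v (m + m)%N - (s (m + m)%N + u (m + m)%N)| + `|s (m + m)%N|.
  set e := v (m + m)%N - _.
  have -> : u (m + m)%N = v (m + m)%N - e - s (m + m)%N.
    by apply/matrixP => i j; rewrite /e !mxE; ring.
  by apply: (le_trans (ler_normB _ _)); rewrite lerD2r ler_normB.
have t3 : `|s0| <= `|v 0%N| + `|u0|.
  have -> : s0 = v 0%N - u0 by rewrite v0E addrK.
  exact: ler_normB.
have N1 := normr_ge0 (s m); have N2 := normr_ge0 (u m).
have W1 : 0 <= E (m + m)%N * w by rewrite mulr_ge0.
rewrite !mulrDl mul1r; lra.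
Qed.

End Estimate.

(** * Uniform expansivity *)

Lemma pseudo_orbit_shift (R : realType) (X : metricType R) (Z : set X)
    (f : X -> X) (d : R) (a N N' : nat) (x : nat -> X) :
  (a + N <= N')%N -> pseudo_orbit Z f d N' x ->
  pseudo_orbit Z f d N (fun i => x (a + i)%N).
Proof.
move=> aN [Cx xs]; split => i iN.
  by apply: Cx; apply: leq_trans aN; rewrite leq_add2l.
by rewrite addnS; apply: xs; apply: leq_trans aN; rewrite ltn_add2l.
Qed.

Section Hyperbolic.
Variables (R : realType) (n : nat) (M : metricType R) (A : atlas R n M).
Variables (g : riemannian_metric A) (f finv : M -> M).
Variables (c : M -> chart_index A) (rho k : R).
Local Notation V := 'rV[R]_n.
Variables (C : set M).
Hypothesis cM : compact [set: M].
Hypothesis fK : cancel f finv.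
Hypotheses (f1 : C1_map A f) (finv1 : C1_map A finv).
Hypothesis UA : uniform_atlas g f c rho k.
Hypothesis hypC : hyperbolic_set g f finv C.

Let cf : continuous f. Proof. by case: f1. Qed.

Let DA (p p' : M) : {linear V -> V} := chart_diff f (c p) (c p') p.

(** Over a window of fixed length a fine pseudo-orbit stays close to the true orbit of its first
    point. Replacing the differentials there raises the defect from [w] to [w + eta * X]; with
    [eta = 1/(4K)] this turns X/4 into X/2. *)
Lemma pseudo_estimate : exists (m : nat) (K d : R), [/\ 0 < K, 0 < d &
  forall x, pseudo_orbit C f d (m + m) x ->
  forall (v : nat -> V) w X, 0 <= w -> (forall l, (l <= m + m)%N -> `|v l| <= X) ->
  (forall l, (l < m + m)%N -> `|v l.+1 - DA (x l) (x l.+1) (v l)| <= w) ->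
  `|v m| <= X / 2 + K * w].
Proof.
have [m [K [K0 H]]] := orbit_estimate fK f1 finv1 UA hypC.
have rho0 := ua_rho_gt0 UA.
pose eta := (4 * K)^-1; have eta0 : 0 < eta by rewrite invr_gt0 mulr_gt0.
have Hr := ua_diff_ucont UA eta0; near ((0:R)^'+) => r.
have r0 : 0 < r by near: r; exact: nbhs_right_gt.
have rP : forall p p' q q', mdist p q <= rho -> mdist p' (f q) <= rho ->
  mdist q q' <= r -> forall w : V,
  `|chart_diff f (c p) (c p') q w - chart_diff f (c p) (c p') q' w| <= eta * `|w|.
  by near: r.
have e0 : 0 < Num.min r rho by rewrite lt_min r0.
have [d d0 dP] := pseudo_orbit_follows cM cf C (m + m) e0.
exists m, K, (Num.min d rho); split => //; first by rewrite lt_min d0.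
move=> x [Cx xs] v w X w0 vX vw.
have xs1 l : (l < m + m)%N -> mdist (x l.+1) (f (x l)) <= rho.
  by move=> lm; rewrite metric_sym (le_trans (xs l lm))// ge_min lexx orbT.
have fol l : (l <= m + m)%N -> mdist (x l) (iter l f (x 0%N)) <= Num.min r rho.
  apply: dP; split => // i im; apply: (le_trans (xs i im)).
  by rewrite ge_min lexx.
have near_x : near_orbit f rho (x 0%N) x (m + m).
  by move=> l lm; rewrite (le_trans (fol l lm))// ge_min lexx orbT.
have X0 : 0 <= X by apply: le_trans (vX 0%N (leq0n _)).
have w'0 : 0 <= w + eta * X by rewrite addr_ge0// mulr_ge0// ltW.
have := H _ _ (Cx 0%N (leq0n _)) near_x v (w + eta * X) X w'0 (vX _ (leq0n _)) (vX _ (leqnn _)).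
have -> : X / 4 + K * (w + eta * X) = X / 2 + K * w.
  by rewrite /eta; field; rewrite gt_eqF.
apply=> l lm.
rewrite -(subrKA (DA (x l) (x l.+1) (v l))).
apply: (le_trans (ler_normD _ _)); apply: lerD; first exact: vw.
have H1 : mdist (x l) (x l) <= rho by rewrite mdistxx ltW.
have H2 : mdist (x l) (iter l f (x 0%N)) <= r.
  by rewrite (le_trans (fol l (ltnW lm)))// ge_min lexx.
have H3 := rP (x l) (x l.+1) (x l) _ H1 (xs1 l lm) H2 (v l).
by apply: (le_trans H3); rewrite ler_pM2l//; apply: vX; exact: ltnW.
Unshelve. all: by end_near. Qed.

(** Let [v l] be the difference of [y l] and [x l] in the chart of [x l]. By strict
    differentiability it follows [Df] with defect at most [2 * tau + eta1 * X], so a bound [X] on a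
    window improves to [3/4 * X + 2 * K * tau] at its middle. Nested windows iterate this. The
    closeness [e] is fixed before [eta]; only [L] and [d] depend on [eta]. *)
Lemma pseudo_orbit_expansive : exists2 e : R, 0 < e &
  forall eta, 0 < eta -> exists (L : nat) (d : R), 0 < d /\
    forall x y, pseudo_orbit C f d (L + L) x -> pseudo_orbit C f d (L + L) y ->
    (forall i, (i <= L + L)%N -> mdist (x i) (y i) <= e) ->
    mdist (x L) (y L) <= eta.
Proof.
have [m [K [d0 [K0 d00 H]]]] := pseudo_estimate.
have rho0 := ua_rho_gt0 UA.
pose eta1 := (4 * K)^-1; have eta10 : 0 < eta1 by rewrite invr_gt0 mulr_gt0.
have Hr := ua_strict UA eta10; near ((0:R)^'+) => r1.
have r10 : 0 < r1 by near: r1; exact: nbhs_right_gt.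
have r1P : forall p p' q, mdist p q <= rho -> mdist p' (f q) <= rho -> forall u v : V,
    `|u - chart (c p) q| <= r1 -> `|v - chart (c p) q| <= r1 ->
    `|in_charts f (c p) (c p') u - in_charts f (c p) (c p') v
       - chart_diff f (c p) (c p') q (u - v)| <= eta1 * `|u - v| by near: r1.
have Hc := ua_chart UA r10; near ((0:R)^'+) => e1.
have e10 : 0 < e1 by near: e1; exact: nbhs_right_gt.
have e1P : forall p q q', mdist p q <= rho -> mdist q q' <= e1 ->
    `|chart (c p) q - chart (c p) q'| <= r1 by near: e1.
exists (Num.min e1 rho); first by rewrite lt_min e10.
move=> eta eta0.
have Hi := ua_chart_inv UA eta0; near ((0:R)^'+) => r2.
have r20 : 0 < r2 by near: r2; exact: nbhs_right_gt.
have r2P : forall p q (y : V), mdist p q <= rho -> `|chart (c p) q - y| <= r2 ->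
    mdist q (chart_inv (c p) y) <= eta /\ chart (c p) (chart_inv (c p) y) = y.
  by near: r2.
(* So that [8 * K * tau], the fixed point of X -> 3/4 X + 2 K tau, is [r2 / 2]; the other half of
   [r2] is left for the geometric term. *)
pose tau := r2 / (16 * K).
have tau0 : 0 < tau by rewrite divr_gt0// mulr_gt0.
have Ht := ua_chart UA tau0; near ((0:R)^'+) => d1.
have d10 : 0 < d1 by near: d1; exact: nbhs_right_gt.
have d1P : forall p q q', mdist p q <= rho -> mdist q q' <= d1 ->
    `|chart (c p) q - chart (c p) q'| <= tau by near: d1.
pose d := Num.min d0 (Num.min d1 rho).
have dd : 0 < d by rewrite !lt_min d00 d10.
have [J JP] : exists J, (3 / 4) ^+ J * r1 <= r2 / 2.
  have : (fun j => (3 / 4 : R) ^+ j) @ \oo --> (0:R).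
    by apply: cvg_expr; rewrite ger0_norm//; lra.
  move=> /cvgrPdist_le/(_ ((r2 / 2) / r1)) []; first by rewrite !divr_gt0.
  move=> J _ /(_ J (leqnn J)); rewrite sub0r normrN ger0_norm; last first.
    by rewrite exprn_ge0// divr_ge0.
  by rewrite ler_pdivlMr// => ?; exists J.
pose v (x y : nat -> M) l : V := chart (c (x l)) (y l) - chart (c (x l)) (x l).
have dom (x p : M) : mdist x p <= rho -> chart_dom (c x) p by exact: (ua_dom UA).
have selfd (p : M) : mdist p p <= rho by rewrite mdistxx ltW.
have step (x y : nat -> M) X : pseudo_orbit C f d (m + m) x ->
    pseudo_orbit C f d (m + m) y ->
    (forall i, (i <= m + m)%N -> mdist (x i) (y i) <= Num.min e1 rho) ->
    (forall i, (i <= m + m)%N -> `|v x y i| <= X) ->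
    `|v x y m| <= 3 / 4 * X + 2 * K * tau.
  move=> [Cx xs] [Cy ys] xy vX.
  have X0 : 0 <= X by apply: le_trans (vX 0%N (leq0n _)).
  have xyr i : (i <= m + m)%N -> mdist (x i) (y i) <= rho.
    by move=> im; apply: (le_trans (xy i im)); rewrite ge_min lexx orbT.
  have w0 : 0 <= 2 * tau + eta1 * X.
    by rewrite addr_ge0// mulr_ge0// ltW.
  have px : pseudo_orbit C f d0 (m + m) x.
    by split => // i im; apply: (le_trans (xs i im)); rewrite ge_min lexx.
  have := H x px (v x y) (2 * tau + eta1 * X) X w0 vX.
  have -> : X / 2 + K * (2 * tau + eta1 * X) = 3 / 4 * X + 2 * K * tau.
    by rewrite /eta1; field; rewrite gt_eqF.
  apply=> l lm.
  have lm' := ltnW lm.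
  have dxs (p q : M) : mdist p q <= d -> mdist q p <= d1.
    by rewrite metric_sym => /le_trans; apply; rewrite !ge_min lexx orbT.
  have xsr : mdist (x l.+1) (f (x l)) <= rho.
    by rewrite metric_sym (le_trans (xs l lm))// !ge_min lexx !orbT.
  have uy : chart_inv (c (x l)) (chart (c (x l)) (y l)) = y l.
    by apply: chartK; apply: dom; exact: xyr.
  have ux : chart_inv (c (x l)) (chart (c (x l)) (x l)) = x l.
    by apply: chartK; exact: dom.
  have B1 : `|chart (c (x l)) (y l) - chart (c (x l)) (x l)| <= r1.
    rewrite distrC; apply: e1P => //.
    by apply: (le_trans (xy l lm')); rewrite ge_min lexx.
  have B0 : `|chart (c (x l)) (x l) - chart (c (x l)) (x l)| <= r1.
    by rewrite subrr normr0 ltW.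
  have := r1P (x l) (x l.+1) (x l) (selfd _) xsr _ _ B1 B0.
  rewrite /in_charts /= uy ux.
  have T1 := d1P (x l.+1) (y l.+1) (f (y l)) (xyr _ lm) (dxs _ _ (ys l lm)).
  have T2 := d1P (x l.+1) (x l.+1) (f (x l)) (selfd _) (dxs _ _ (xs l lm)).
  rewrite -/(v x y l) -/(DA (x l) (x l.+1)) => H3.
  have {}H3 := le_trans H3 (ler_wpM2l (ltW eta10) (vX l lm')).
  set Dv := DA _ _ _ in H3 *.
  rewrite {1}/v.
  set a := chart _ (y l.+1) in T1 *; set a' := chart _ (f (y l)) in T1 H3.
  set b := chart _ (x l.+1) in T2 *; set b' := chart _ (f (x l)) in T2 H3.
  have -> : a - b - Dv = (a - a') - (b - b') + (a' - b' - Dv).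
    by apply/matrixP => i j; rewrite !mxE; ring.
  apply: (le_trans (ler_normD _ _)); apply: lerD => //.
  apply: (le_trans (ler_normB _ _)); rewrite mulrDl mul1r; exact: lerD.
have main j (x y : nat -> M) : pseudo_orbit C f d (m * j + m * j) x ->
    pseudo_orbit C f d (m * j + m * j) y ->
    (forall i, (i <= m * j + m * j)%N -> mdist (x i) (y i) <= Num.min e1 rho) ->
    `|v x y (m * j)%N| <= (3 / 4) ^+ j * r1 + 8 * K * tau.
  elim: j x y => [|j IH] x y px py xy.
    rewrite muln0 expr0 mul1r; apply: (@le_trans _ _ r1).
      rewrite /v distrC; apply: e1P => //; apply: (le_trans (xy 0%N _)) => //.
      by rewrite ge_min lexx.
    rewrite lerDl; apply: mulr_ge0; last exact: ltW.
    by apply: mulr_ge0; last exact: ltW.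
  set B := (3 / 4) ^+ j * r1 + 8 * K * tau in IH.
  have -> : (3 / 4) ^+ j.+1 * r1 + 8 * K * tau = 3 / 4 * B + 2 * K * tau.
    by rewrite /B exprS; field.
  have -> : (m * j.+1 = m * j + m)%N by rewrite mulnS addnC.
  have s0 i l : (i <= m + m)%N -> (l <= m * j + m * j)%N ->
      (i + l <= m * j.+1 + m * j.+1)%N.
    by move=> im lm; rewrite mulnS addnACA; apply: leq_add.
  have s1 : (m * j + (m + m) <= m * j.+1 + m * j.+1)%N.
    by rewrite addnC s0// leq_addr.
  have := step (fun i => x (m * j + i)%N) (fun i => y (m * j + i)%N) B
    (pseudo_orbit_shift s1 px) (pseudo_orbit_shift s1 py).
  apply=> i im; first by apply: xy; rewrite addnC s0// leq_addr.
  have s2 : (i + (m * j + m * j) <= m * j.+1 + m * j.+1)%N by rewrite s0.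
  have := IH _ _ (pseudo_orbit_shift s2 px) (pseudo_orbit_shift s2 py).
  by rewrite /v [(i + m * j)%N]addnC; apply=> l lm; apply: xy; rewrite s0.
exists (m * J)%N, d; split => // x y px py xy.
have := main J x y px py xy; rewrite /v distrC => vJ.
have vr2 : `|chart (c (x (m * J)%N)) (x (m * J)%N) - chart (c (x (m * J)%N)) (y (m * J)%N)| <= r2.
  apply: (le_trans vJ); rewrite [r2 in X in _ <= X]splitr; apply: lerD => //.
  suff -> : 8 * K * tau = r2 / 2 by [].
  by rewrite /tau; field; rewrite gt_eqF.
have [+ _] := r2P _ _ _ (selfd _) vr2.
rewrite chartK//; apply: dom; apply: (le_trans (xy _ (leq_addr _ _))).
by rewrite ge_min lexx orbT.
Unshelve. all: by end_near. Qed.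

End Hyperbolic.

(** * Shadowing of closed pseudo-orbits *)

(** Matrices serve as the complete normed space in which the contraction principle is applied. *)
HB.instance Definition _ (R : realType) m n :=
  Complete.copy 'M[R]_(m, n) 'M[R]_(m, n).

Lemma contraction_fixpoint (R : realType) (X : completeNormedModType R)
    (U : set X) (h : X -> X) (q : R) :
  closed U -> U !=set0 -> (forall x, U x -> U (h x)) -> 0 <= q < 1 ->
  (forall x y, U x -> U y -> `|h x - h y| <= q * `|x - y|) ->
  exists2 x, U x & x = h x.
Proof.
move=> clU U0 hU /andP[q0 q1] hq.
pose h' : {fun U >-> U} := mkfun_fun hU.
have ctr : is_contraction h'.
  exists (NngNum q0); split => //= -[x y] [/= Ux Uy]; exact: hq.
exact: (banach_fixed_point ctr clU U0).
Qed.

Lemma row_norm_le (R : realType) m n (W : 'M[R]_(m, n)) i : `|row i W| <= `|W|.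
Proof.
by apply: mx_norm_le => // a b; rewrite mxE; exact: mx_norm_entry.
Qed.

Lemma rows_norm_le (R : realType) m n (W : 'M[R]_(m, n)) (b : R) :
  0 <= b -> (forall i, `|row i W| <= b) -> `|W| <= b.
Proof.
move=> b0 Wb; apply: mx_norm_le => // i j; apply: le_trans (Wb i).
by have := mx_norm_entry (row i W) 0 j; rewrite mxE.
Qed.

Section Shadowing.
Variables (R : realType) (n : nat) (M : metricType R) (A : atlas R n M).
Variables (g : riemannian_metric A) (f finv : M -> M).
Variables (c : M -> chart_index A) (rho k : R).
Local Notation V := 'rV[R]_n.
Variables (C : set M).
Hypothesis cM : compact [set: M].
Hypothesis fK : cancel f finv.
Hypotheses (f1 : C1_map A f) (finv1 : C1_map A finv).
Hypothesis UA : uniform_atlas g f c rho k.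
Hypothesis hypC : hyperbolic_set g f finv C.

Let cf : continuous f. Proof. by case: f1. Qed.

Let DA (p p' : M) : {linear V -> V} := chart_diff f (c p) (c p') p.

Section Loop.
Variables (N' : nat) (X : nat -> M).
Local Notation N := N'.+1.
Hypothesis X_per : forall i, X (i + N)%N = X i.

Let idx (i : nat) : 'I_N := Ordinal (ltn_pmod i (ltn0Sn N')).

Let idx_ord (i : 'I_N) : idx i = i.
Proof. by apply: val_inj; rewrite /= modn_small. Qed.

Let X_mul i j : X (i + N * j)%N = X i.
Proof.
elim: j => [|j IH]; first by rewrite muln0 addn0.
by rewrite mulnS [(N + _)%N]addnC addnA X_per.
Qed.

Let X_idx i : X (idx i) = X i.
Proof. by rewrite {2}(divn_eq i N) addnC mulnC X_mul. Qed.

(** A periodic sequence of vectors along the loop is stored as a matrix, one row per position, so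
    that source and target are the same finite-dimensional space. *)
Definition loop_op (W : 'M[R]_(N, n)) : 'M[R]_(N, n) :=
  \matrix_(i < N) (row (idx i.+1) W - DA (X i) (X i.+1) (row i W)).

Lemma row_loop_op W (i : nat) :
  row (idx i) (loop_op W) =
  row (idx i.+1) W - DA (X i) (X i.+1) (row (idx i) W).
Proof.
apply: (eq_trans (rowK _ _)).
have E1 : idx (idx i).+1 = idx i.+1.
  by apply: val_inj; rewrite /= -addn1 modnDml addn1.
have E2 : X (idx i).+1 = X i.+1 by rewrite -[RHS]X_idx -[LHS]X_idx E1.
by rewrite E1 E2 X_idx.
Qed.

Lemma loop_op_linear : linear loop_op.
Proof.
move=> a W W'; apply/row_matrixP => i; rewrite -(idx_ord i).
rewrite [RHS]linearP /= !row_loop_op !linearP /=.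
set u := DA _ _ _; set u' := DA _ _ _.
by apply/matrixP => j l; rewrite !mxE; ring.
Qed.

HB.instance Definition _ := GRing.isLinear.Build R 'M[R]_(N, n) 'M[R]_(N, n)
  *:%R loop_op loop_op_linear.

Variables (m : nat) (K d : R).
Hypothesis K_gt0 : 0 < K.
Hypothesis estimate : forall x, pseudo_orbit C f d (m + m) x ->
  forall (v : nat -> V) w X, 0 <= w -> (forall l, (l <= m + m)%N -> `|v l| <= X) ->
  (forall l, (l < m + m)%N -> `|v l.+1 - DA (x l) (x l.+1) (v l)| <= w) ->
  `|v m| <= X / 2 + K * w.
Hypothesis X_C : forall i, C (X i).
Hypothesis X_d : forall i, mdist (f (X i)) (X i.+1) <= d.

Lemma loop_op_bound W : `|W| <= 2 * K * `|loop_op W|.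
Proof.
suff : `|W| <= `|W| / 2 + K * `|loop_op W| by lra.
apply: rows_norm_le.
  by rewrite addr_ge0// mulr_ge0// ltW.
move=> j.
(* A start with [s + m] congruent to [j] modulo [N]: the window of length [m + m] is centred at [j]
   and may wind around the loop several times. *)
pose s := (j + m * N')%N.
have sm : idx (s + m) = j.
  apply: val_inj; rewrite /= /s -addnA -mulnSr addnC modnMDl.
  exact: modn_small.
rewrite -sm.
apply: (@estimate (fun i => X (s + i)%N) _ (fun i => row (idx (s + i)) W)) => //.
- by split => i _ //; rewrite addnS.
- by move=> l _; exact: row_norm_le.
- by move=> l _; rewrite addnS -row_loop_op; exact: row_norm_le.
Qed.

Lemma loop_op_inv : exists Linv : {linear 'M[R]_(N, n) -> 'M[R]_(N, n)},
  (forall Y, loop_op (Linv Y) = Y) /\ forall Y, `|Linv Y| <= 2 * K * `|Y|.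
Proof.
have ker0 : lker (linfun loop_op) == 0%VS.
  rewrite -subv0; apply/subvP => W; rewrite memv_ker lfunE /= => /eqP W0.
  rewrite memv0 -normr_le0; apply: (le_trans (loop_op_bound W)).
  by rewrite W0 normr0 mulr0.
exists ((linfun loop_op)^-1)%VF.
have inv Y : loop_op ((linfun loop_op)^-1%VF Y) = Y.
  by have := lker0_lfunVK ker0 Y; rewrite lfunE.
by split => // Y; rewrite -[Y in _ * `|Y|]inv; exact: loop_op_bound.
Qed.

Let psi i : V := chart (c (X i)) (X i).
Let F i : V -> V := in_charts f (c (X i)) (c (X i.+1)).

(** The equation reads [loop_op W = E W] with [E] the nonlinear remainder. As [E] is [eta]-Lipschitz
    and the inverse of [loop_op] is bounded by [2 * K], the map [Phi] contracts by 1/2; also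
    [|Phi 0| <= r / 2], so it preserves the ball of radius [r]. *)
Lemma loop_solution (r eta tau : R) : 0 < r -> 0 <= eta -> 4 * K * eta <= 1 ->
  0 <= tau -> 4 * K * tau <= r ->
  (forall i u v, `|u - psi i| <= r -> `|v - psi i| <= r ->
    `|F i u - F i v - DA (X i) (X i.+1) (u - v)| <= eta * `|u - v|) ->
  (forall i, `|F i (psi i) - psi i.+1| <= tau) ->
  exists v : nat -> V, [/\ forall i, `|v i| <= r, forall i, v (i + N)%N = v i &
    forall i, F i (psi i + v i) = psi i.+1 + v i.+1].
Proof.
move=> r0 eta0 eta1 tau0 tau1 strict defect.
have [Linv [LK Lb]] := loop_op_inv.
pose E (W : 'M[R]_(N, n)) : 'M[R]_(N, n) := \matrix_(i < N)
  (F i (psi i + row i W) - psi i.+1 - DA (X i) (X i.+1) (row i W)).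
have EE W i : row (idx i) (E W) =
    F i (psi i + row (idx i) W) - psi i.+1 - DA (X i) (X i.+1) (row (idx i) W).
  apply: (eq_trans (rowK _ _)).
  have E1 : idx (idx i).+1 = idx i.+1.
    by apply: val_inj; rewrite /= -addn1 modnDml addn1.
  have E2 : X (idx i).+1 = X i.+1 by rewrite -[RHS]X_idx -[LHS]X_idx E1.
  by rewrite /F /psi E2 X_idx.
have psi_r i w : `|w| <= r -> `|psi i + w - psi i| <= r.
  by rewrite addrC addKr.
have Elip W W' : `|W| <= r -> `|W'| <= r -> `|E W - E W'| <= eta * `|W - W'|.
  move=> Wr W'r; apply: rows_norm_le; first by rewrite mulr_ge0.
  move=> i; rewrite -(idx_ord i) linearB /= !EE.
  set w := row _ W; set w' := row _ W'.
  have wr : `|w| <= r by apply: le_trans Wr; exact: row_norm_le.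
  have w'r : `|w'| <= r by apply: le_trans W'r; exact: row_norm_le.
  have H := strict i _ _ (psi_r i w wr) (psi_r i w' w'r).
  have ww : psi i + w - (psi i + w') = w - w'.
    by rewrite opprD addrACA subrr add0r.
  rewrite ww linearB in H.
  have wW : `|w - w'| <= `|W - W'|.
    by rewrite /w /w' -linearB; exact: row_norm_le.
  apply: le_trans (ler_wpM2l eta0 wW); apply: le_trans H.
  rewrite le_eqVlt; apply/orP; left; apply/eqP; congr (`|_|).
  set a := F i _; set b := F i _; set u := DA _ _ _; set u' := DA _ _ _.
  by apply/matrixP => p q; rewrite !mxE; ring.
have E0 : `|E 0| <= tau.
  apply: rows_norm_le => // i; rewrite -(idx_ord i) EE.
  by rewrite row0 addr0 linear0 subr0.
pose Phi W := Linv (E W).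
have Plip W W' : `|W| <= r -> `|W'| <= r -> `|Phi W - Phi W'| <= 1 / 2 * `|W - W'|.
  move=> Wr W'r; rewrite /Phi -linearB; apply: (le_trans (Lb _)).
  apply: (le_trans (ler_wpM2l _ (Elip W W' Wr W'r))).
    by rewrite mulr_ge0// ltW.
  by rewrite mulrA ler_wpM2r//; lra.
have [W Wr WE] : exists2 W, `|W| <= r & W = Phi W.
  apply: (@contraction_fixpoint R 'M[R]_(N, n) [set W | `|W| <= r] Phi (1 / 2)).
  - have -> : [set W : 'M[R]_(N, n) | `|W| <= r] =
       (Num.norm : 'M[R]_(N, n) -> R) @^-1` [set t | t <= r] by [].
    by apply: closed_comp => [y _|]; [exact: norm_continuous|exact: closed_le].
  - by exists 0; rewrite /= normr0 ltW.
  - move=> W /= Wr.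
    have H0 : `|0 : 'M[R]_(N, n)| <= r by rewrite normr0 ltW.
    rewrite -(subrK (Phi 0) (Phi W)); apply: (le_trans (ler_normD _ _)).
    have H1 := Plip W 0 Wr H0; rewrite subr0 in H1.
    have H2 : `|Phi 0| <= 2 * K * tau.
      apply: (le_trans (Lb _)); apply: ler_wpM2l => //.
      by rewrite mulr_ge0// ltW.
    by lra.
  - by apply/andP; split; lra.
  - by move=> x y; exact: Plip.
exists (fun i => row (idx i) W); split.
- by move=> i; apply: le_trans Wr; exact: row_norm_le.
- move=> i; congr (row _ W); apply: val_inj.
  by rewrite /= modnDr.
- move=> i.
  have H : loop_op W = E W by rewrite {1}WE LK.
  have := congr1 (row (idx i)) H; rewrite row_loop_op EE => /addIr ->.
  by rewrite [RHS]addrC subrK.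
Qed.

End Loop.

Lemma loop_shadowing (eps : R) : 0 < eps -> exists2 d : R, 0 < d &
  forall N x, (0 < N)%N -> pseudo_orbit C f d N x -> x N = x 0%N ->
  exists z, forall i, (i <= N)%N -> mdist (iter i f z) (x i) <= eps.
Proof.
move=> eps0; have rho0 := ua_rho_gt0 UA.
have [m [K [d0 [K0 d00 H]]]] := pseudo_estimate cM fK f1 finv1 UA hypC.
have rho2 : 0 < rho / 2 by rewrite divr_gt0.
have [df df0 dfP] := compact_ucont cM cf rho2.
pose eps' := Num.min (Num.min eps rho) df.
have eps'0 : 0 < eps' by rewrite !lt_min eps0 rho0.
pose eta := (4 * K)^-1; have eta0 : 0 < eta by rewrite invr_gt0 mulr_gt0.
have Hr := ua_strict UA eta0; have Hi := ua_chart_inv UA eps'0.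
near ((0:R)^'+) => r.
have r0 : 0 < r by near: r; exact: nbhs_right_gt.
have rP : forall p p' q, mdist p q <= rho -> mdist p' (f q) <= rho -> forall u v : V,
    `|u - chart (c p) q| <= r -> `|v - chart (c p) q| <= r ->
    `|in_charts f (c p) (c p') u - in_charts f (c p) (c p') v
       - chart_diff f (c p) (c p') q (u - v)| <= eta * `|u - v| by near: r.
have riP : forall p q (y : V), mdist p q <= rho -> `|chart (c p) q - y| <= r ->
    mdist q (chart_inv (c p) y) <= eps' /\ chart (c p) (chart_inv (c p) y) = y.
  by near: r.
pose tau := r / (4 * K); have tau0 : 0 < tau by rewrite divr_gt0// mulr_gt0.
have Ht := ua_chart UA tau0; near ((0:R)^'+) => d1.
have d10 : 0 < d1 by near: d1; exact: nbhs_right_gt.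
have d1P : forall p q q', mdist p q <= rho -> mdist q q' <= d1 ->
    `|chart (c p) q - chart (c p) q'| <= tau by near: d1.
pose d := Num.min (Num.min d0 d1) (rho / 2).
have dd : 0 < d by rewrite !lt_min d00 d10.
exists d => // -[//|N'] x _ [Cx xs] xN.
pose X i := x (i %% N'.+1)%N.
have Xlt i : (i %% N'.+1 < N'.+1)%N by rewrite ltn_mod.
have X_per i : X (i + N'.+1)%N = X i by rewrite /X modnDr.
have X_C i : C (X i) by apply: Cx; exact: ltnW.
have XE i : (i <= N'.+1)%N -> X i = x i.
  rewrite leq_eqVlt => /orP[/eqP ->|lt]; last by rewrite /X modn_small.
  by rewrite /X modnn xN.
have X_d i : mdist (f (X i)) (X i.+1) <= d.
  have -> : X i.+1 = x (i %% N'.+1).+1.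
    have <- := XE (i %% N'.+1).+1 (Xlt i).
    by rewrite /X -addn1 -[(i %% N'.+1).+1]addn1 modnDml.
  exact: xs.
have X_d0 i : mdist (f (X i)) (X i.+1) <= d0.
  by apply: (le_trans (X_d i)); rewrite !ge_min lexx.
have selfd (p : M) : mdist p p <= rho by rewrite mdistxx ltW.
have X_rho2 i : mdist (X i.+1) (f (X i)) <= rho / 2.
  by rewrite metric_sym (le_trans (X_d i))// !ge_min lexx orbT.
have X_rho i : mdist (X i.+1) (f (X i)) <= rho.
  by apply: (le_trans (X_rho2 i)); lra.
have dom (p q : M) : mdist p q <= rho -> chart_dom (c p) q by exact: (ua_dom UA).
have K4 : 4 * K * eta <= 1 by rewrite /eta mulfV// gt_eqF// mulr_gt0.
have K4t : 4 * K * tau <= r.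
  by rewrite /tau mulrC divfK// gt_eqF// mulr_gt0.
have strict i (u v : V) : `|u - chart (c (X i)) (X i)| <= r ->
    `|v - chart (c (X i)) (X i)| <= r ->
    `|in_charts f (c (X i)) (c (X i.+1)) u - in_charts f (c (X i)) (c (X i.+1)) v
       - DA (X i) (X i.+1) (u - v)| <= eta * `|u - v|.
  by apply: rP => //; exact: X_rho.
have defect i : `|in_charts f (c (X i)) (c (X i.+1)) (chart (c (X i)) (X i))
    - chart (c (X i.+1)) (X i.+1)| <= tau.
  rewrite /in_charts /= (chartK (dom _ _ (selfd (X i)))) distrC.
  apply: d1P => //; rewrite metric_sym; apply: (le_trans (X_d i)).
  by rewrite !ge_min lexx orbT.
have [v [vr v_per vE]] := loop_solution X_per K0 H X_C X_d0 r0 (ltW eta0) K4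
  (ltW tau0) K4t strict defect.
pose z i := chart_inv (c (X i)) (chart (c (X i)) (X i) + v i).
have zP i : mdist (X i) (z i) <= eps' /\
    chart (c (X i)) (z i) = chart (c (X i)) (X i) + v i.
  by apply: riP => //; rewrite opprD addNKr normrN.
have z_rho i : mdist (X i) (z i) <= rho.
  by apply: (le_trans (zP i).1); rewrite !ge_min lexx orbT.
have z_df i : mdist (X i) (z i) <= df.
  by apply: (le_trans (zP i).1); rewrite !ge_min lexx orbT.
(* The equation holds in the chart of [X i.+1]. It yields equality of points because both lie in its
   domain: for [f (z i)], the jump of the pseudo-orbit and the modulus of continuity [df] each cost
   [rho / 2]. *)
have fz i : f (z i) = z i.+1.
  have q1 : chart_dom (c (X i.+1)) (f (z i)).
    apply: dom; apply: (le_trans (metric_triangle _ (f (X i)) _)).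
    by rewrite [rho in X in _ <= X]splitr lerD// dfP.
  have q2 := dom _ _ (z_rho i.+1).
  have [_ zi] := zP i; have [_ zi1] := zP i.+1.
  have E : chart (c (X i.+1)) (f (z i)) = chart (c (X i.+1)) (z i.+1).
    rewrite zi1 -vE -zi /in_charts /=; congr (chart _ (f _)).
    by rewrite (chartK (dom _ _ (z_rho i))).
  by rewrite -(chartK q1) E chartK.
have iterz i : iter i f (z 0%N) = z i by elim: i => // i IH; rewrite iterS IH fz.
exists (z 0%N) => i iN; rewrite iterz metric_sym -XE//.
by apply: (le_trans (zP i).1); rewrite !ge_min lexx.
Unshelve. all: by end_near. Qed.

End Shadowing.

(** * Loops of equal length *)

Section Chains.
Variables (R : realType) (M : metricType R) (f finv : M -> M) (C : set M).
Hypotheses (fK : cancel f finv) (finvK : cancel finv f).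
Hypothesis fC : f @` C = C.

Definition chain (d : R) (N : nat) (a b : M) : Prop :=
  exists x, [/\ pseudo_orbit C f d N x, x 0%N = a & x N = b].

Definition concat (N : nat) (x y : nat -> M) (i : nat) : M :=
  if (i < N)%N then x i else y (i - N)%N.

Lemma concat_pseudo_orbit d N N' x y : pseudo_orbit C f d N x ->
  pseudo_orbit C f d N' y -> x N = y 0%N ->
  pseudo_orbit C f d (N + N') (concat N x y).
Proof.
move=> [Cx xs] [Cy ys] xy; rewrite /concat; split=> i iN.
  by case: ltnP => iN'; [apply: Cx; exact: ltnW|apply: Cy; rewrite leq_subLR].
case: ltnP => iN'; last first.
  rewrite ifN ?subSn// -?leqNgt; first by apply: ys; rewrite ltn_subLR.
  exact: leq_trans iN' _.
case: ltnP => iN''; first exact: xs.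
have E : i.+1 = N by apply/eqP; rewrite eqn_leq iN' iN''.
by rewrite E subnn -xy -E; apply: xs; rewrite E.
Qed.

Lemma chain_trans d N N' a b e : chain d N a b -> chain d N' b e ->
  chain d (N + N') a e.
Proof.
move=> [x [px x0 xN]] [y [py y0 yN]]; exists (concat N x y); split.
- by apply: concat_pseudo_orbit => //; rewrite xN y0.
- rewrite /concat; case: ltnP => // N0.
  have E : N = 0%N by apply/eqP; rewrite -leqn0.
  by rewrite sub0n y0 -xN E.
- by rewrite /concat ltnNge leq_addr /= addKn.
Qed.

Let CP x : C x -> C (f x). Proof. by move=> Cx; rewrite -fC; exists x. Qed.

Let CV x : C x -> C (finv x).
Proof. by rewrite -{1}fC => -[y Cy <-]; rewrite fK. Qed.

Let CiterP j x : C x -> C (iter j f x).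
Proof. by move=> Cx; elim: j => //= j; exact: CP. Qed.

Let CiterV j x : C x -> C (iter j finv x).
Proof. by move=> Cx; elim: j => //= j; exact: CV. Qed.

Let iterK j x : iter j f (iter j finv x) = x.
Proof. by elim: j x => // j IH x; rewrite iterSr iterS finvK IH. Qed.

Lemma orbit_pseudo_orbit d N x : 0 <= d -> C x ->
  pseudo_orbit C f d N (fun i => iter i f x).
Proof.
by move=> d0 Cx; split=> i _; [exact: CiterP|rewrite iterS mdistxx].
Qed.

Lemma orbit_chain d N x : 0 <= d -> C x -> chain d N x (iter N f x).
Proof. by move=> d0 Cx; exists (fun i => iter i f x); split=> //; exact: orbit_pseudo_orbit. Qed.

Variable d : R.
Hypothesis d0 : 0 < d.
Hypothesis trC : forall a b, C a -> C b -> exists2 N, (0 < N)%N & chain d N a b.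

(** Visiting the other point equalizes the lengths: x, p, y, p and y, p, x, p take k + S + l and l +
    S + k steps. *)
Lemma chain_return x y p S : C x -> C y -> C p ->
  chain d S p x -> chain d S p y -> exists R', chain d R' x p /\ chain d R' y p.
Proof.
move=> Cx Cy Cp px py; have [k _ xp] := trC Cx Cp; have [l _ yp] := trC Cy Cp.
exists (k + S + l)%N; split; first exact: chain_trans (chain_trans xp py) yp.
have -> : (k + S + l = l + S + k)%N by lia.
exact: chain_trans (chain_trans yp px) xp.
Qed.

Lemma chain_return_rev x y p S : C x -> C y -> C p ->
  chain d S x p -> chain d S y p -> exists R', chain d R' p x /\ chain d R' p y.
Proof.
move=> Cx Cy Cp xp yp; have [k _ px] := trC Cp Cx; have [l _ py] := trC Cp Cy.
exists (k + S + l)%N; split; last exact: chain_trans (chain_trans px xp) py.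
have -> : (k + S + l = l + S + k)%N by lia.
exact: chain_trans (chain_trans py yp) px.
Qed.

Lemma chain_loops p a j : chain d a p p -> C p -> chain d (j * a) p p.
Proof.
move=> ap Cp; elim: j => [|j IH].
  rewrite mul0n; exists (fun _ => p); split => //; split => //.
by rewrite mulSn; exact: chain_trans ap IH.
Qed.

Hypothesis infC : infinite_set C.

(** Pigeonhole: take a chain from [p] to each point of the infinite set and reduce its length modulo
    the length [a] of a loop at [p]. Two points share a residue, and copies of the loop pad the
    shorter chain. *)
Lemma equal_length_chains : exists p q q' S,
  [/\ C p, C q, C q', q <> q' & chain d S p q /\ chain d S p q'].
Proof.
have [p Cp] := infinite_setN0 infC.
have [a a0 loop] := trC Cp Cp.
have len q : exists N, C q -> chain d N p q.
  have [Cq|nCq] := pselect (C q); last by exists 0%N.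
  by have [N _ H] := trC Cp Cq; exists N.
have [N NP] := choice len.
pose h q := (N q %% a)%N.
have [hinj|] := pselect {in C &, injective h}.
  exfalso; apply: infC; rewrite -(eq_finite_set (inj_card_eq hinj)).
  by apply: sub_finite_set (finite_II a) => _ [q _ <-]; rewrite /= ltn_mod.
move=> /existsNP [q /existsNP [q' /not_implyP [/set_mem Cq /not_implyP [/set_mem Cq']]]].
move=> /not_implyP [hq qq'].
wlog le : q q' Cq Cq' hq qq' / (N q <= N q')%N.
  move=> W; have [le|/ltnW le] := leqP (N q) (N q'); first exact: (W q q').
  by apply: (W q' q) => //; move=> /esym.
exists p, q, q', (N q'); split => //; split; last exact: NP.
have -> : (N q' = (N q' - N q) %/ a * a + N q)%N.
  rewrite divnK ?subnK// -eqn_mod_dvd//; exact/eqP/esym.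
exact: chain_trans (chain_loops _ loop Cp) (NP _ Cq).
Qed.

Variable e : R.
Hypothesis e0 : 0 < e.
Hypothesis expC : forall x y, C x -> C y ->
  (forall j, mdist (iter j f x) (iter j f y) <= e) ->
  (forall j, mdist (iter j finv x) (iter j finv y) <= e) -> x = y.

(** The two points reached by chains of equal length separate under some iterate of [f] or of
    [finv]. These orbit pieces extend the chains equally, and returns to [p] of a common length
    close them up with a single [T]. *)
Lemma separated_loops : exists x y T, [/\ (0 < T)%N, C x, C y & e < mdist x y] /\
  [/\ chain d T x x, chain d T x y & chain d T y x].
Proof.
have [p [q [q' [S [Cp Cq Cq' qq' [pq pq']]]]]] := equal_length_chains.
have [x [y [T [Cx Cy xy [tr1 tr2 tr3]]]]] : exists x y T, [/\ C x, C y, e < mdist x y &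
    [/\ chain d T x x, chain d T x y & chain d T y x]].
  have [j [sep|sep]] : exists j, e < mdist (iter j f q) (iter j f q') \/
      e < mdist (iter j finv q) (iter j finv q').
    apply/not_existsP => H; apply: qq'; apply: expC => // j.
      by rewrite leNgt; apply/negP => ?; apply: (H j); left.
    by rewrite leNgt; apply/negP => ?; apply: (H j); right.
  - have px := chain_trans pq (orbit_chain j (ltW d0) Cq).
    have py := chain_trans pq' (orbit_chain j (ltW d0) Cq').
    have [R' [xp yp]] := chain_return (CiterP j Cq) (CiterP j Cq') Cp px py.
    exists (iter j f q), (iter j f q'), (R' + (S + j))%N; split => //.
    - exact: CiterP.
    - exact: CiterP.
    - by split; apply: chain_trans; eassumption.
  - have [R' [qp qp']] := chain_return Cq Cq' Cp pq pq'.
    have xq := orbit_chain j (ltW d0) (CiterV j Cq); rewrite iterK in xq.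
    have yq := orbit_chain j (ltW d0) (CiterV j Cq'); rewrite iterK in yq.
    have xp := chain_trans xq qp; have yp := chain_trans yq qp'.
    have [S' [px py]] := chain_return_rev (CiterV j Cq) (CiterV j Cq') Cp xp yp.
    exists (iter j finv q), (iter j finv q'), (j + R' + S')%N; split => //.
    - exact: CiterV.
    - exact: CiterV.
    - by split; apply: chain_trans; eassumption.
exists x, y, T; split; split => //; rewrite lt0n; apply/eqP => T0.
move: tr2; rewrite T0 => -[z [_ z0 zT]]; move: xy.
by rewrite -z0 -zT mdistxx ltNge ltW.
Qed.

End Chains.

(** * Recognizable blocks *)

Section Coding.
Variables (R : realType) (M : metricType R) (f : M -> M) (C : set M).
Variables (d e : R) (x y : M) (T : nat) (u v : nat -> M).
Hypotheses (T_gt0 : (0 < T)%N) (e_xy : e < mdist x y) (e_ge0 : 0 <= e).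
Local Notation N := (T + T)%N.
Hypotheses (pu : pseudo_orbit C f d N u) (pv : pseudo_orbit C f d N v).
Hypotheses (u0 : u 0%N = x) (v0 : v 0%N = x) (uN : u N = x) (vN : v N = x).
Hypotheses (uT : u T = x) (vT : v T = y).

Definition splice (w : nat -> bool) (i : nat) : M :=
  (if w (i %/ N)%N then v else u) (i %% N)%N.

Let N_gt0 : (0 < N)%N. Proof. by rewrite addn_gt0 T_gt0. Qed.

Lemma splice_block w t r : (r < N)%N ->
  splice w (t * N + r) = (if w t then v else u) r.
Proof.
by move=> rN; rewrite /splice divnMDl// divn_small// addn0 modnMDl modn_small.
Qed.

Lemma splice0 w t : splice w (t * N) = x.
Proof. by rewrite -[(t * N)%N]addn0 splice_block//; case: (w t). Qed.

Lemma splice_pseudo_orbit w k : pseudo_orbit C f d k (splice w).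
Proof.
have [Cu us] := pu; have [Cv vs] := pv; split=> i _.
  have lt : (i %% N <= N)%N by rewrite ltnW// ltn_mod.
  by rewrite /splice; case: (w _); [exact: Cv|exact: Cu].
rewrite {1 2}(divn_eq i N); set t := (i %/ N)%N; set r := (i %% N)%N.
have rN : (r < N)%N by rewrite ltn_mod.
rewrite splice_block// -addnS.
have [rN'|rN'] := ltnP r.+1 N.
  by rewrite splice_block//; case: (w t); [exact: vs|exact: us].
have rE : r.+1 = N by apply/eqP; rewrite eqn_leq rN rN'.
rewrite [in X in mdist _ (splice _ (_ + X))]rE -[X in (_ + X)%N]mul1n -mulnDl splice0.
by case: (w t); [have := vs r rN; rewrite rE vN|have := us r rN; rewrite rE uN].
Qed.

Variable L : nat.
Hypothesis expans : forall s s', pseudo_orbit C f d (L + L) s ->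
  pseudo_orbit C f d (L + L) s' ->
  (forall i, (i <= L + L)%N -> mdist (s i) (s' i) <= e) ->
  mdist (s L) (s' L) <= e / 2.

Local Notation K := (L + N + 1)%N.
Local Notation B := (K + K + 1)%N.

(** The code 1 0^(K-1) 1 0^K, in blocks of length [B]. Around the second mark there is room for the
    [N] uses of expansivity in [no_self_overlap]. *)
Definition marker (j : nat) : bool := (j == 0)%N || (j == K).

Definition marked (s : nat -> bool) (j : nat) : bool :=
  s (j %/ B)%N && marker (j %% B)%N.

Lemma marker_double : marker (K + K) = false.
Proof. by rewrite /marker; apply/negP => /orP[/eqP|/eqP]; lia. Qed.

Lemma marked_block s b j : (j < B)%N -> marked s (b * B + j) = s b && marker j.
Proof.
move=> jB; have B0 : (0 < B)%N by rewrite addn1.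
by rewrite /marked divnMDl// divn_small// addn0 modnMDl modn_small.
Qed.

Lemma splice_marked (s : nat -> bool) b l : s b -> (l < B * N)%N ->
  splice (marked s) (b * (B * N) + l) = splice marker l.
Proof.
move=> sb lB; rewrite (divn_eq l N) mulnA addnA -mulnDl.
have qB : (l %/ N < B)%N by rewrite ltn_divLR.
by rewrite !splice_block ?ltn_mod// marked_block// sb.
Qed.

Lemma marked_pair s t : marked s t && marked s t.+1 = false.
Proof.
apply/negP => /andP[]; rewrite (divn_eq t B).
set b := (t %/ B)%N; set j := (t %% B)%N.
have jB : (j < B)%N by rewrite ltn_mod addn1.
rewrite marked_block// => /andP[_ /orP[/eqP ->|/eqP ->]].
  rewrite -addnS marked_block; last by lia.
  by move=> /andP[_ /orP[/eqP|/eqP]]; lia.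
rewrite -addnS marked_block; last by lia.
by move=> /andP[_ /orP[/eqP|/eqP]]; lia.
Qed.

(* A shift of a marked block by [sigma] that stays close to itself would,      *)
(* [N] steps later, identify the positions [K] and [K + sigma] of the code.    *)
Lemma no_self_overlap (s : nat -> bool) b sigma : s b -> (0 < sigma < N)%N ->
  ~ (forall l, (l + N <= B * N)%N ->
      mdist (splice (marked s) (b * B * N + l))
            (splice (marked s) (b * B * N + (l + sigma))) <= e / 2).
Proof.
move=> sb /andP[sg0 sgN] H.
pose X l := splice (marked s) (b * B * N + l).
(* Composing one more shift with the previous [j] gives closeness e/2 + e/2 on a window, which
   expansivity improves back to e/2 at its middle. The margins [j * L] and [j * (L + N)] pay for the
   windows and the shifts. For [j = N] the total shift is a whole number [sigma] of code
   positions. *)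
have Q j l : (j * L <= l)%N -> (l + j * (L + N) + N <= B * N)%N ->
    mdist (X l) (X (l + j * sigma)%N) <= e / 2.
  elim: j l => [|j IH] l l1 l2.
    by rewrite mul0n addn0 mdistxx divr_ge0.
  have lL : (L <= l)%N by apply: leq_trans l1; rewrite mulSn leq_addr.
  have shift k : pseudo_orbit C f d (L + L) (fun i => X (k + i)%N).
    have := pseudo_orbit_shift (leqnn _) (splice_pseudo_orbit (marked s) (b * B * N + k + (L + L))).
    move=> [H1 H2]; split => i iL.
      by rewrite /X addnA; apply: H1.
    by rewrite /X !(addnA _ k); exact: H2.
  have := expans (shift (l - L)%N) (shift (l - L + j.+1 * sigma)%N).
  rewrite subnK// addnAC subnK//; apply => i iL.
  set a := (l - L + i)%N.
  have -> : (l - L + j.+1 * sigma + i = a + sigma + j * sigma)%N.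
    by rewrite /a mulSn; lia.
  rewrite [e]splitr; apply: (le_trans (metric_triangle _ (X (a + sigma)%N) _)).
  move: l1 l2; rewrite !mulSn => l1 l2.
  apply: lerD; first by apply: H; rewrite /a; lia.
  by apply: IH; rewrite /a; lia.
have h1 : (N * L <= K * N + T)%N.
  by rewrite mulnC; apply: (leq_trans _ (leq_addr _ _)); rewrite leq_mul2r; lia.
have h2 : (K * N + T + N * (L + N) + N <= B * N)%N.
  have -> : (B * N = K * N + (L * N + N * N + N) + N)%N by lia.
  by lia.
have TN : (T < N)%N by lia.
have XK : X (K * N + T)%N = y.
  rewrite /X addnA -mulnDl splice_block// marked_block; last by lia.
  by rewrite sb /marker eqxx orbT.
have XKs : X (K * N + T + N * sigma)%N = x.
  have -> : (K * N + T + N * sigma = (K + sigma) * N + T)%N by lia.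
  have E : (b * B * N + ((K + sigma) * N + T) = (b * B + (K + sigma)) * N + T)%N by lia.
  rewrite /X E splice_block// marked_block; last by lia.
  have -> : marker (K + sigma) = false by rewrite /marker; apply/negP => /orP[/eqP|/eqP]; lia.
  by rewrite andbF.
have := Q N _ h1 h2; rewrite XK XKs metric_sym => yx.
have := lt_le_trans e_xy yx; rewrite ltNge => /negP; apply.
by rewrite ler_pdivrMr// ler_peMr// ler1n.
Qed.

(** The window is sampled where the marker passes through [x] or [y]. This first aligns the code up
    to a block, then [no_self_overlap] removes the remaining phase [r]. *)
Lemma marker_recognition (s : nat -> bool) i :
  (forall l, (l < B * N)%N ->
     mdist (splice marker l) (splice (marked s) (i + l)) <= e / 2) ->
  exists2 b, i = (b * (B * N))%N & s b.
Proof.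
move=> H.
have TN : (T < N)%N by lia.
pose t := (i %/ N)%N; pose r := (i %% N)%N.
have rN : (r < N)%N by rewrite ltn_mod.
have iE : i = (t * N + r)%N by exact: divn_eq.
pose t' := (t + (r + T) %/ N)%N; pose r' := ((r + T) %% N)%N.
have rE : (r + T = (r + T) %/ N * N + r')%N by exact: divn_eq.
have r'N : (r' < N)%N by rewrite ltn_mod.
pose Z (c : bool) := (if c then v else u) r'.
have far : ~ (exists z, mdist x z <= e / 2 /\ mdist y z <= e / 2).
  move=> [z [xz yz]]; have := metric_triangle x z y.
  by rewrite leNgt (metric_sym z) => /negP; apply; apply: le_lt_trans e_xy; lra.
(* At these times the code sequence is always at phase [r'] of a loop, so only the two points
   [Z false] and [Z true] occur. By [far] neither can be close to both [x] and [y], so equal symbols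
   in the code force equal symbols in the marker. *)
have HZ j : (j < B)%N ->
    mdist (if marker j then y else x) (Z (marked s (t' + j)%N)) <= e / 2.
  move=> jB; have lB : (j * N + T < B * N)%N.
    have : (j.+1 * N <= B * N)%N by rewrite leq_mul2r jB orbT.
    by rewrite mulSn; lia.
  have := H _ lB; rewrite splice_block//.
  have -> : (i + (j * N + T) = (t' + j) * N + r')%N.
    by rewrite {1}iE /t' !mulnDl; lia.
  by rewrite splice_block// -/(Z _); case: (marker j); rewrite ?vT ?uT.
have mark0 : marker 0 by [].
have mark1 : marker 1 = false by rewrite /marker /=; apply/negP => /eqP; lia.
have mark2 : marker 2 = false by rewrite /marker /=; apply/negP => /eqP; lia.
have Z0 := HZ 0%N ltac:(lia); have Z1 := HZ 1%N ltac:(lia).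
have Z2 := HZ 2%N ltac:(lia).
rewrite mark0 addn0 in Z0; rewrite mark1 in Z1; rewrite mark2 in Z2.
have neq01 : marked s t' != marked s (t' + 1)%N.
  by apply/eqP => E; apply: far; exists (Z (marked s t')); split => //; rewrite E.
have neq02 : marked s t' != marked s (t' + 2)%N.
  by apply/eqP => E; apply: far; exists (Z (marked s t')); split => //; rewrite E.
(* The code read from [t'] could also be the complement of the marker, but that would have adjacent
   marks at [t' + 1] and [t' + 2]. *)
have mt' : marked s t'.
  have := marked_pair s (t' + 1)%N; rewrite -addnS.
  by move: neq01 neq02; do 3 case: (marked s _).
have all_marks j : (j < B)%N -> marked s (t' + j)%N = marker j.
  move=> jB; have Zj := HZ j jB; rewrite mt' in neq01 Z0.
  have m1 : marked s (t' + 1)%N = false by move: neq01; case: (marked s _).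
  rewrite m1 in Z1.
  case: (marker j) Zj; case: (marked s (t' + j)%N) => // Zj; exfalso; apply: far.
    by exists (Z false).
  by exists (Z true).
(* A mark sits at position 0 or [K] of an active block. Starting at [K] would require another mark
   at [K + K], where there is none. *)
have [b t'E sb] : exists2 b, t' = (b * B)%N & s b.
  have B0 : (0 < B)%N by rewrite addn1.
  move: mt'; rewrite {1}(divn_eq t' B) marked_block ?ltn_mod//.
  move=> /andP[sb /orP[/eqP E|/eqP E]].
    by exists (t' %/ B)%N => //; rewrite {1}(divn_eq t' B) E addn0.
  have KB : (K < B)%N by rewrite [B]addn1 ltnS leq_addr.
  have KKB : (K + K < B)%N by rewrite [B]addn1.
  have := all_marks K KB; rewrite {1}(divn_eq t' B) E -addnA marked_block//.
  by rewrite marker_double /marker eqxx orbT andbF.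
(* The window starts [r] steps after the beginning of the block, or [N - r] steps before it; unless
   [r = 0], the block would overlap itself. *)
have [rT|rT] := ltnP (r + T) N.
  have E1 : t' = t by rewrite /t' divn_small// addn0.
  have [r0|r0] := posnP r.
    by exists b => //; rewrite iE r0 addn0 -E1 t'E mulnA.
  exfalso; apply: (@no_self_overlap s b r sb); first by rewrite r0 rN.
  move=> l lB; have lB' : (l < B * N)%N.
    by apply: leq_trans lB; rewrite -addn1 leq_add2l.
  have := H l lB'; rewrite iE -E1 t'E -mulnA splice_marked//.
  by rewrite -(addnA _ r l) (addnC r l).
exfalso; pose sigma := (N - r)%N.
have r0 : (0 < r)%N.
  by rewrite lt0n; apply/eqP => r0; move: rT; rewrite r0 leqNgt TN.
have E1 : t' = t.+1.
  rewrite /t' -(subnKC rT) divnDl ?dvdnn// divnn N_gt0 divn_small ?addn0 ?addn1//.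
  rewrite ltn_subLR//; apply: (@leq_trans (r + N)); first by rewrite ltn_add2l.
  by rewrite leq_add2r ltnW.
have iS : (i + sigma = b * (B * N))%N.
  by rewrite mulnA -t'E E1 iE -addnA subnKC ?(ltnW rN)// mulSn addnC.
apply: (@no_self_overlap s b sigma sb).
  by rewrite subn_gt0 rN /= ltn_subrL r0 N_gt0.
move=> l lB.
have sgB : (l + sigma < B * N)%N.
  by apply: leq_trans lB; rewrite -addnS leq_add2l ltn_subrL r0 N_gt0.
have := H _ sgB; rewrite -mulnA metric_sym -(splice_marked sb sgB).
by rewrite (addnC l sigma) (addnA i) iS.
Qed.

End Coding.

(** * Test functions *)

Lemma limn_esup_le0P (R : realType) (u : nat -> R) :
  ~ (0 < limn_esup (fun k => (u k)%:E))%E <->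
  forall eta, 0 < eta -> \forall k \near \oo, u k <= eta.
Proof.
split=> [H eta eta0|H].
  have : (limn_esup (fun k => (u k)%:E) < eta%:E)%E.
    by apply: (@le_lt_trans _ _ 0%E); rewrite ?lte_fin// leNgt; apply/negP.
  move=> /ereal_inf_lt[_ [V oV <-] lt]; apply: filterS oV => k Vk.
  rewrite -lee_fin; apply: le_trans (ltW lt).
  by apply: ereal_sup_ubound; exists k.
move=> lim0; have [eta eta0 etaP] : exists2 eta, 0 < eta &
    (eta%:E < limn_esup (fun k => (u k)%:E))%E.
  case: (limn_esup _) lim0 => [r| |//]; last by move=> _; exists 1; rewrite ?ltry.
  by rewrite lte_fin => r0; exists (r / 2); rewrite ?lte_fin; lra.
move: etaP; apply/negP; rewrite -leNgt.
apply: le_trans (ereal_inf_lbound _) _; first by exists [set k | u k <= eta] => //; exact: H.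
by apply: ge_ereal_sup => _ [k /= uk <-]; rewrite lee_fin.
Qed.

Section TestFunction.
Variables (R : realType) (M : metricType R) (f : M -> M).
Hypotheses (cM : compact [set: M]) (cf : continuous f).

Lemma iter_continuous k : continuous (iter k f).
Proof.
elim: k => [|k IH] x; first exact: cvg_id.
have -> : iter k.+1 f = f \o iter k f by [].
by apply: continuous_comp; [exact: IH|exact: cf].
Qed.

(** The condition at each time is closed in the starting point and holds for all large [J], so it
    passes to a cluster point. *)
Lemma shadow_limit (eps : R) (x : nat -> M) :
  (forall J, exists z, forall i, (i <= J)%N -> mdist (iter i f z) (x i) <= eps) ->
  exists z, forall i, mdist (iter i f z) (x i) <= eps.
Proof.
move=> /choice [z zP].
have [p [_ clp]] := cM (fmap_proper_filter z _) (filterT : (z @ \oo) setT).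
exists p => i; pose E := [set w | mdist (x i) (iter i f w) <= eps].
have clE : closed E.
  have -> : E = (iter i f) @^-1` [set w | mdist (x i) w <= eps] by [].
  apply: closed_comp; last exact: closed_mdist_le.
  by move=> w _; exact: iter_continuous.
suff : E p by rewrite /E /= metric_sym.
apply: clE => U Up; apply: clp => //.
by exists i => // J /= iJ; rewrite /E /= metric_sym; exact: zP.
Qed.

Definition bump (eps t : R) : R := Num.min 1 (Num.max 0 (2 - t / eps)).

Lemma bump1 eps t : 0 < eps -> t <= eps -> bump eps t = 1.
Proof.
move=> eps0 te; rewrite /bump min_l// le_max; apply/orP; right.
have : t / eps <= 1 by rewrite ler_pdivrMr// mul1r.
lra.
Qed.

Lemma bump0 eps t : 0 < eps -> 2 * eps <= t -> bump eps t = 0.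
Proof.
move=> eps0 te; have : 2 <= t / eps by rewrite ler_pdivlMr.
move=> te2; rewrite /bump max_l; last by lra.
by rewrite min_r// ler01.
Qed.

Lemma bump_continuous eps : continuous (bump eps).
Proof.
have -> : bump eps = (cst 1 : R -> R^o) \min
    ((cst 0 : R -> R^o) \max (fun t => 2 - t / eps)) by [].
move=> t; apply: continuous_min; first exact: cst_continuous.
apply: continuous_max; first exact: cst_continuous.
by apply: continuousB; [exact: cst_continuous|exact: mulrr_continuous].
Qed.

Definition window_test (eps : R) (P : nat) (W : nat -> M) (z : M) : R :=
  \prod_(l < P) bump eps (mdist (W l) (iter l f z)).

Lemma window_test_continuous eps P W : continuous (window_test eps P W).
Proof.
apply: continuous_big => [|l _]; first exact: mul_continuous.
move=> z; have H1 : {for z, continuous (iter l f)} by exact: iter_continuous.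
have H2 := continuous_comp H1 (@mdist_continuous _ _ (W l) _).
exact: (continuous_comp H2 (@bump_continuous eps _)).
Qed.

Lemma window_test1 eps P W z : 0 < eps ->
  (forall l, (l < P)%N -> mdist (W l) (iter l f z) <= eps) ->
  window_test eps P W z = 1.
Proof.
by move=> eps0 H; rewrite /window_test big1// => l _; apply: bump1 => //; exact: H.
Qed.

Lemma window_test0 eps P W z l : 0 < eps -> (l < P)%N ->
  2 * eps <= mdist (W l) (iter l f z) -> window_test eps P W z = 0.
Proof.
move=> eps0 lP H; rewrite /window_test (bigD1 (Ordinal lP))//= bump0//.
by rewrite mul0r.
Qed.

(* Sorting indices by residue and by the sign of [a i] writes the sum of the   *)
(* [`|a i|] as a combination of [2 * P] sums along orbits, which therefore     *)
(* cannot all be negligible.                                                   *)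
Lemma bohr_chaotic_residue (P : nat) : (0 < P)%N ->
  (forall (r : 'I_P) (s : nat -> bool), exists (x : M) (phi : M -> R),
     continuous phi /\
     forall i, phi (iter i f x) = ((i %% P == r)%N && s i)%:R) ->
  bohr_chaotic f.
Proof.
move=> P0 H a _; apply: contraPP => Hn; apply/limn_esup_le0P => eta eta0.
pose sg (b : bool) (i : nat) := if b then 0 < a i else a i < 0.
have /choice [x /choice [phi phiP]] : forall rb : 'I_P * bool,
    exists (x : M) (phi : M -> R), continuous phi /\
    forall i, phi (iter i f x) = ((i %% P == rb.1)%N && sg rb.2 i)%:R.
  by move=> rb; exact: H.
pose T rb k := \sum_(0 <= i < k) a i * phi rb (iter i f (x rb)).
pose eta' := eta / (2 * P%:R).
have P0' : 0 < P%:R :> R by rewrite ltr0n.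
have eta'0 : 0 < eta' by rewrite divr_gt0// mulr_gt0.
have small rb : \forall k \near \oo, k%:R^-1 * `|T rb k| <= eta'.
  have : ~ (0 < limn_esup (fun k => (k%:R^-1 * `|T rb k|)%:E))%E.
    by move=> pos; apply: Hn; exists (x rb), (phi rb); split => //; have [] := phiP rb.
  by move=> /limn_esup_le0P; apply.
have all_small : \forall k \near \oo, forall rb, k%:R^-1 * `|T rb k| <= eta'.
  exact: filter_forall.
have split_abs i : `|a i| = \sum_(r < P)
    (a i * phi (r, true) (iter i f (x (r, true)))
     - a i * phi (r, false) (iter i f (x (r, false)))).
  have iP : (i %% P < P)%N by rewrite ltn_mod.
  rewrite (bigD1 (Ordinal iP))//= big1 ?addr0; last first.
    move=> r; rewrite -val_eqE /= eq_sym => /negPf rP.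
    by rewrite !(phiP _).2 /= rP mulr0 subrr.
  rewrite !(phiP _).2 /= eqxx /= /sg /=.
  have [ai|ai|->] := ltrgt0P (a i).
  - by rewrite mulr1 mulr0 subr0.
  - by rewrite mulr1 mulr0 sub0r.
  - by rewrite !mul0r subrr.
apply: filterS all_small => k Hk.
have le_sum : \sum_(0 <= i < k) `|a i| <=
    \sum_(r < P) (`|T (r, true) k| + `|T (r, false) k|).
  rewrite (eq_bigr _ (fun i _ => split_abs i)) exchange_big /=.
  apply: ler_sum => r _; rewrite big_split /= sumrN.
  by apply: (le_trans (ler_norm _)); exact: ler_normB.
apply: (@le_trans _ _ (k%:R^-1 * \sum_(r < P) (`|T (r, true) k| + `|T (r, false) k|))).
  by apply: ler_wpM2l => //; rewrite invr_ge0.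
rewrite mulr_sumr; apply: (@le_trans _ _ (\sum_(r < P) (eta' + eta'))).
  by apply: ler_sum => r _; rewrite mulrDr lerD.
rewrite sumr_const card_ord -mulr_natl /eta'.
have -> : P%:R * (eta / (2 * P%:R) + eta / (2 * P%:R)) = eta by field; rewrite gt_eqF.
by [].
Qed.

End TestFunction.

(** * Bohr chaos *)

Section ShadowingExpansive.
Variables (R : realType) (M : metricType R) (f finv : M -> M) (C : set M).
Hypotheses (cM : compact [set: M]) (cf : continuous f).
Hypotheses (fK : cancel f finv) (finvK : cancel finv f).
Hypotheses (fC : f @` C = C) (infC : infinite_set C).
Hypothesis trC : chain_transitive_on C f.
Hypothesis shadC : forall eps, 0 < eps -> exists2 d : R, 0 < d &
  forall N x, (0 < N)%N -> pseudo_orbit C f d N x -> x N = x 0%N ->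
  exists z, forall i, (i <= N)%N -> mdist (iter i f z) (x i) <= eps.
Hypothesis expC : exists2 e : R, 0 < e &
  forall eta, 0 < eta -> exists (L : nat) (d : R), 0 < d /\
    forall x y, pseudo_orbit C f d (L + L) x -> pseudo_orbit C f d (L + L) y ->
    (forall i, (i <= L + L)%N -> mdist (x i) (y i) <= e) ->
    mdist (x L) (y L) <= eta.

Lemma pseudo_orbit_le d d' N x : d <= d' -> pseudo_orbit C f d N x ->
  pseudo_orbit C f d' N x.
Proof. by move=> dd' [Cx xs]; split => // i iN; apply: le_trans (xs i iN) dd'. Qed.

Let CV x : C x -> C (finv x).
Proof. by rewrite -{1}fC => -[y Cy <-]; rewrite fK. Qed.

(** Orbit segments are pseudo-orbits for every [d], so one [e] makes the distance smaller than every
    [eta]. The segment starts at [iter L finv x] to have [x] at its middle. *)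
Lemma expansive_orbits : exists2 e : R, 0 < e &
  (forall eta, 0 < eta -> exists (L : nat) (d : R), 0 < d /\
    forall x y, pseudo_orbit C f d (L + L) x -> pseudo_orbit C f d (L + L) y ->
    (forall i, (i <= L + L)%N -> mdist (x i) (y i) <= e) ->
    mdist (x L) (y L) <= eta) /\
  forall x y, C x -> C y ->
  (forall j, mdist (iter j f x) (iter j f y) <= e) ->
  (forall j, mdist (iter j finv x) (iter j finv y) <= e) -> x = y.
Proof.
have [e e0 eP] := expC; exists e => //; split => // x y Cx Cy fwd bwd.
apply: mdist_positivity; apply/eqP; rewrite eq_le mdist_ge0 andbT.
apply/ler_addgt0Pl => eta eta0; rewrite addr0.
have [L [d [d0 H]]] := eP _ eta0.
have CiterV j z : C z -> C (iter j finv z).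
  by move=> Cz; elim: j => //= j; exact: CV.
have iterVK j z : iter j f (iter j finv z) = z.
  by elim: j z => // j IH z; rewrite iterSr iterS finvK IH.
have orb z : C z -> pseudo_orbit C f d (L + L) (fun i => iter i f (iter L finv z)).
  by move=> Cz; apply: orbit_pseudo_orbit => //; [exact: ltW|exact: CiterV].
have := H _ _ (orb x Cx) (orb y Cy); rewrite /= !iterVK; apply => i _.
have [iL|/ltnW Li] := leqP i L.
  rewrite -(subnKC iL) [iter (i + _) finv x]iterD [iter (i + _) finv y]iterD.
  by rewrite !iterVK.
rewrite -(subnK Li) ![iter (_ + L) f _]iterD !iterVK; exact: fwd.
Qed.

Lemma shadowing_expansive_bohr_chaotic : bohr_chaotic f.
Proof.
have [e e0 [eP expansive]] := expansive_orbits.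
have e2 : 0 < e / 2 by rewrite divr_gt0.
(* The shadowing error is e/6 and the bump vanishes beyond e/3; a code point more than e/2 from the
   window then gives an orbit point beyond e/2 - e/6 = e/3. *)
have e6 : 0 < e / 6 by rewrite divr_gt0.
have [L [d1 [d10 exps]]] := eP _ e2.
have [d2 d20 shad] := shadC e6.
pose d := Num.min d1 d2; have d0 : 0 < d by rewrite lt_min d10.
have dd1 : d <= d1 by rewrite ge_min lexx.
have dd2 : d <= d2 by rewrite ge_min lexx orbT.
have tr a b : C a -> C b -> exists2 N, (0 < N)%N & chain f C d N a b.
  move=> Ca Cb; have [N [s [[N0 sC sd] s0 sN]]] := trC Ca Cb d0.
  by exists N => //; exists s.
have [x [y [T [[T0 Cx Cy xy] [xx xy' yx]]]]] :=
  separated_loops fK finvK fC d0 tr infC e0 expansive.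
have [su [pu u0 uT]] := xx; have [sv [pv v0 vT]] := xy'; have [sw [pw w0 wT]] := yx.
pose u := concat T su su; pose v := concat T sv sw.
have cat_mid a b : concat T a b T = b 0%N by rewrite /concat ltnn subnn.
have cat0 a b : concat T a b 0%N = a 0%N by rewrite /concat T0.
have catT a b : concat T a b (T + T)%N = b T.
  by rewrite /concat ltnNge leq_addr /= addKn.
have Pu : pseudo_orbit C f d (T + T) u.
  by apply: concat_pseudo_orbit => //; rewrite uT u0.
have Pv : pseudo_orbit C f d (T + T) v.
  by apply: concat_pseudo_orbit => //; rewrite vT w0.
have Eu0 : u 0%N = x by rewrite /u cat0.
have Ev0 : v 0%N = x by rewrite /v cat0.
have EuN : u (T + T)%N = x by rewrite /u catT.
have EvN : v (T + T)%N = x by rewrite /v catT.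
have EuT : u T = x by rewrite /u cat_mid.
have EvT : v T = y by rewrite /v cat_mid.
have exps' s s' : pseudo_orbit C f d (L + L) s -> pseudo_orbit C f d (L + L) s' ->
    (forall i, (i <= L + L)%N -> mdist (s i) (s' i) <= e) ->
    mdist (s L) (s' L) <= e / 2.
  by move=> ps ps'; apply: exps; exact: pseudo_orbit_le dd1 _.
have recog := marker_recognition T0 xy (ltW e0) Pu Pv Eu0 Ev0 EuN EvN EuT EvT exps'.
set N := (T + T)%N in recog.
pose K := (L + N + 1)%N; pose B := (K + K + 1)%N; pose P := (B * N)%N.
have N0 : (0 < N)%N by rewrite addn_gt0 T0.
have P0 : (0 < P)%N by rewrite muln_gt0 N0 /B addn1.
pose W l := splice T u v (marker T L) l.
apply: (@bohr_chaotic_residue _ _ f P P0) => r s.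
(* Time [i] along the final orbit is time [i + (P - r)] of the code, so block [b] starts at
   [i = (b - 1) * P + r]. Block 0 starts before the orbit does and is left inactive. *)
pose s' j := (0 < j)%N && s (j.-1 * P + r)%N.
pose code := splice T u v (marked T L s').
have [z zP] : exists z, forall i, mdist (iter i f z) (code i) <= e / 6.
  apply: (shadow_limit cM cf) => J.
  have pcode : pseudo_orbit C f d2 (J.+1 * N) code.
    by apply: (pseudo_orbit_le dd2); exact: (splice_pseudo_orbit T0 Pu Pv Eu0 Ev0 EuN EvN).
  (* Every multiple of [N] returns to the base point [x], so each initial segment extends to a
     closed pseudo-orbit. *)
  have loop : code (J.+1 * N)%N = code 0%N.
    rewrite -[0%N](mul0n N) /code.
    by rewrite !(splice0 T0 Eu0 Ev0).
  have JN : (0 < J.+1 * N)%N by rewrite muln_gt0 N0.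
  have [z Hz] := shad _ _ JN pcode loop.
  by exists z => i iJ; apply: Hz; apply: (leq_trans iJ); rewrite mulSn; nia.
exists (iter (P - r) f z), (window_test f (e / 6) P W); split.
  exact: window_test_continuous.
move=> i; rewrite -iterD.
have rP : (r <= P)%N by rewrite ltnW.
set t := (i + (P - r))%N.
have [[b tb sb]|nb] := pselect (exists2 b, t = (b * P)%N & s' b).
  have b0 : (0 < b)%N by case/andP: sb.
  have iE : i = (b.-1 * P + r)%N.
    move: tb; rewrite /t -{1}(prednK b0) mulSn => tb.
    by apply/eqP; rewrite -(eqn_add2r (P - r)); apply/eqP; rewrite tb; lia.
  have -> : (i %% P == r)%N by rewrite iE modnMDl modn_small.
  have -> : s i by case/andP: sb => _; rewrite -iE.
  apply: window_test1 => // l lP; rewrite -iterD.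
  rewrite metric_sym addnC tb.
  have -> : W l = code (b * P + l)%N.
    by rewrite /W /code -(splice_marked u v T0 sb lP).
  by rewrite addnC; have := zP (l + b * P)%N; rewrite addnC.
have -> : ((i %% P == r)%N && s i) = false.
  apply/negP => /andP[/eqP ir si]; apply: nb; exists (i %/ P).+1.
    by rewrite /t {1}(divn_eq i P) ir -addnA subnKC// mulSn addnC.
  by rewrite /s' /= -ir -divn_eq.
have [l lP far] : exists2 l, (l < P)%N & e / 2 < mdist (W l) (code (t + l)%N).
  apply/not_exists2P => H; apply: nb; have [] := recog s' t.
    by move=> l lP; have [//|/negP] := H l; rewrite -leNgt.
  by move=> b tb sb; exists b.
apply: (window_test0 (l := l)) => //; rewrite -iterD addnC.
have := metric_triangle (W l) (iter (t + l) f z) (code (t + l)%N).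
have := zP (t + l)%N; lra.
Qed.

End ShadowingExpansive.

Unset Implicit Arguments.

Theorem corollary2 (R : realType) (n : nat) (M : metricType R)
    (A : atlas R n M) (g : riemannian_metric A) (f finv : M -> M)
    (C : set M) :
  compact (@setT M) ->
  C1_diffeo A f finv ->
  infinite_set C ->
  hyperbolic_set g f finv C ->
  chain_transitive_on C f ->
  bohr_chaotic f.
Proof.
move=> cM [fK finvK f1 finv1] infC hypC trC.
have [c [rho [k UA]]] := uniform_atlas_exists g cM f1.
have cf : continuous f by case: f1.
have fC : f @` C = C by case: hypC.
apply: (shadowing_expansive_bohr_chaotic cM cf fK finvK fC infC trC).
  exact: (loop_shadowing cM fK f1 finv1 UA hypC).
exact: (pseudo_orbit_expansive cM fK f1 finv1 UA hypC).
Qed.
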